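(* Let $\mathbf d_q:\mathcal V(\theta_q)\to\mathcal V(\theta_{q-1})$ ($q\ge1$) be the $\mathfrak g$-module homomorphism with $\mathbf d_q(y_n\otimes(e^*_{m+n})^q\otimes1_{\mathcal E})=1\otimes(e^*_{m+n})^{q-1}\otimes1_{\mathcal E}$, and $\mathbf d_0=0$. Then $\mathbf d_q\circ\mathbf d_{q+1}=0$ for all $q\ge0$, and: (1) $\mathcal V(\theta_q)$ is reducible for every $q\ge1$; (2) $\operatorname{Im}\mathbf d_{q+1}\cong L(\theta_q)$ for all $q\ge0$; (3) $\ker\mathbf d_q=\operatorname{Im}\mathbf d_{q+1}$ for all $q\ge0$ with $q\ne m$; (4) $\ker\mathbf d_m/\operatorname{Im}\mathbf d_{m+1}$ is the one-dimensional trivial $\mathfrak g$-module (spanned by the class of $y_1\cdots y_n\otimes e_1^*\cdots e_m^*\otimes1_{\mathcal E}$).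
   Context: $\mathbb F$ algebraically closed of characteristic $0$, $m,n\ge1$. $\mathcal R=\mathbb F[x_1,\dots,x_m]\otimes\Lambda(y_1,\dots,y_n)$ ($x_i$ even, $y_s$ odd). $\mathfrak g=W(m,n)$ the Lie superalgebra of superderivations of $\mathcal R$, free over $\mathcal R$ on even $\partial_i$ and odd $D_t$, with $\mathfrak g_0\cong\mathfrak{gl}(m|n)$ via $x_i\partial_j\mapsto E_{ij}$, $x_iD_s\mapsto E_{i,m+s}$, $y_r\partial_j\mapsto E_{m+r,j}$, $y_rD_s\mapsto E_{m+r,m+s}$. $\mathcal E=\sum_{i=1}^m\epsilon_i-\sum_{j=1}^n\delta_j$, $\theta_q=\mathcal E-q\delta_n$. $L^0(\theta_q)$ is realized as $\Omega^q(V^* )\otimes\mathbb F_{\mathcal E}$, where $V^*$ is the dual of the natural module $\mathbb F^{m|n}$ with dual basis $e_i^*$ ($e^*_i$ even iff $i\le m$), $\Omega^q(V^* )$ its $q$-th super-Grassmann power (even vectors anticommute, odd vectors commute; products written by juxtaposition), and $\mathbb F_{\mathcal E}=\mathbb F1_{\mathcal E}$ the one-dimensional module of weight $\mathcal E$. For dominant integral $\lambda$, $\mathcal V(\lambda)=\mathcal R\otimes L^0(\lambda)$ is the mixed-product module (homogeneous $f,g$, $\xi$ the $\mathfrak g_0$-action: $f\partial_i.(g\otimes v)=f\partial_i(g)\otimes v+\sum_j\partial_j(f)g\otimes\xi(x_j\partial_i)v+(-1)^{\wp(f)+\wp(g)+1}\sum_jD_j(f)g\otimes\xi(y_j\partial_i)v$,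 $fD_i.(g\otimes v)=fD_i(g)\otimes v+(-1)^{\wp(g)}\sum_j\partial_j(f)g\otimes\xi(x_jD_i)v+(-1)^{\wp(f)+1}\sum_jD_j(f)g\otimes\xi(y_jD_i)v$), and $L(\lambda)$ is its unique simple submodule $U(\mathfrak g)(1\otimes L^0(\lambda))$. The vector $y_n\otimes(e^*_{m+n})^q\otimes1_{\mathcal E}$ generates $\mathcal V(\theta_q)$. *)

(* Defs.v *)
From HB Require Import structures.
From mathcomp Require Import all_boot all_order all_algebra.
From mathcomp Require Import finmap.
From mathcomp.multinomials Require Import monalg.
Set Implicit Arguments. Unset Strict Implicit. Unset Printing Implicit Defensive.
Import Order.TTheory GRing.Theory.
Local Open Scope ring_scope.

Section WmnModules.
Variables (F : fieldType) (m n : nat).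

(* Monomials x^a y^S of R = F[x_1..x_m] (x) Lambda(y_1..y_n);
   y^S = y_{s1} ... y_{sk} with s1 < ... < sk. *)
Definition Rmon := ({ffun 'I_m -> nat} * {set 'I_n})%type.
(* Monomials of Omega(Vdual): e*_T (e*_{m+1})^{b_1} ... (e*_{m+n})^{b_n},
   e*_T = e*_{t1} ... e*_{tk}, t1 < ... < tk (the even e*_i, i <= m). *)
Definition OmMon := ({set 'I_m} * {ffun 'I_n -> nat})%type.
(* Basis of V = R (x) Omega(Vdual) (x) F_E :  (x^a y^S) (x) omega (x) 1_E *)
Definition Bas := (Rmon * OmMon)%type.

Definition RR := {malg F[Rmon]}.
Definition L0 := {malg F[OmMon]}.      (* Omega(Vdual) (x) F_E *)
Definition MM := {malg F[Bas]}.

Definition lext (K : choiceType) (V : lmodType F) (h : K -> V)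
  (v : {malg F[K]}) : V := \sum_(k <- msupp v) v@_k *: h k.
Definition bilext (K1 K2 : choiceType) (V : lmodType F) (h : K1 -> K2 -> V)
  (u : {malg F[K1]}) (v : {malg F[K2]}) : V :=
  \sum_(k1 <- msupp u) \sum_(k2 <- msupp v) (u@_k1 * v@_k2) *: h k1 k2.

Definition sgn (k : nat) : F := (-1) ^+ k.

Definition rpar (r : Rmon) : nat := #|r.2|.   (* parity (mod 2) *)

Definition mulmon (r1 r2 : Rmon) : RR :=
  if [disjoint r1.2 & r2.2] then
    sgn #|[set p : 'I_n * 'I_n | (p.1 \in r1.2) && (p.2 \in r2.2) && (p.2 < p.1)%N]|
      *: << ([ffun i => r1.1 i + r2.1 i]%N, r1.2 :|: r2.2) >>
  else 0.
Definition mulR : RR -> RR -> RR := bilext mulmon.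

Definition dxmon (j : 'I_m) (r : Rmon) : RR :=
  (r.1 j)%:R *: << ([ffun i => r.1 i - (i == j)]%N, r.2) >>.
Definition dymon (j : 'I_n) (r : Rmon) : RR :=
  if j \in r.2 then
    sgn #|[set s in r.2 | (s < j)%N]| *: << (r.1, r.2 :\ j) >>
  else 0.
Definition dx j : RR -> RR := lext (dxmon j).
Definition dy j : RR -> RR := lext (dymon j).

(* index set {1..m+n}: inl i = i (even), inr s = m+s (odd) *)
Definition idx := ('I_m + 'I_n)%type.
Definition ipar (k : idx) : nat := if k is inr _ then 1%N else 0%N.
Definition evenb (k : idx) : bool := if k is inl _ then true else false.

Definition idx_lt (k l : idx) : bool :=
  match k, l with
  | inl i, inl i' => (i < i')%N
  | inl _, inr _ => true
  | _, _ => false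
  end.

(* Omega(Vdual): even e* anticommute (and square to 0), odd e* commute,
   even and odd e* anticommute  (vw = -(-1)^{|v||w|} wv). *)
Fixpoint winv (w : seq idx) : nat :=
  if w is x :: w' then (count (fun y => idx_lt y x) w' + winv w')%N else 0%N.

Definition evens (w : seq idx) : seq 'I_m :=
  pmap (fun k : idx => if k is inl i then Some i else None) w.
Definition nodd (w : seq idx) : nat := count (fun k => ~~ evenb k) w.

Definition omprod (w : seq idx) : L0 :=
  if uniq (evens w) then
    sgn (winv w) *: << ([set i | i \in evens w],
                        [ffun s => count_mem (inr s : idx) w]) >>
  else 0.

Definition omword (o : OmMon) : seq idx :=
  [seq (inl i : idx) | i <- enum o.1] ++
  flatten [seq nseq (o.2 s) (inr s : idx) | s <- enum 'I_n].
Definition omdeg (o : OmMon) : nat := (#|o.1| + \sum_(s < n) o.2 s)%N.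

(* E_{kl} acting on Vdual : E_{kl}.e*_p = -(-1)^{|E_kl||p|} delta_{pk} e*_l,
   extended to Omega(Vdual) as an (even/odd) superderivation, and tensored
   with F_E, where E(E_kk) = 1 (k even), -1 (k odd). *)
Definition Ecoef (k : idx) : F := if evenb k then 1 else -1.
Definition xi (k l : idx) (o : OmMon) : L0 :=
  let w := omword o in
  let pX := (ipar k + ipar l)%N in
  \sum_(t < size w)
     (if nth l w t == k then
        (sgn (pX * nodd (take t w)) * - sgn (pX * ipar k))
          *: omprod (set_nth l w t l)
      else 0)
  + (if k == l then Ecoef k *: << o >> else 0).

Definition tens : RR -> L0 -> MM := bilext (fun r o => << (r, o) >>).

(* action of f d_i  (f = the monomial c) on the basis element g (x) v *)
Definition actPb (c : Rmon) (i : 'I_m) (b : Bas) : MM :=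
  let: (r, o) := b in
  tens (mulR << c >> (dxmon i r)) << o >>
  + \sum_(j < m) tens (mulR (dxmon j c) << r >>) (xi (inl j) (inl i) o)
  + sgn (rpar c + rpar r + 1) *:
      \sum_(j < n) tens (mulR (dymon j c) << r >>) (xi (inr j) (inl i) o).

(* action of f D_i  (f = the monomial c) on the basis element g (x) v *)
Definition actDb (c : Rmon) (i : 'I_n) (b : Bas) : MM :=
  let: (r, o) := b in
  tens (mulR << c >> (dymon i r)) << o >>
  + sgn (rpar r) *:
      \sum_(j < m) tens (mulR (dxmon j c) << r >>) (xi (inl j) (inr i) o)
  + sgn (rpar c + 1) *:
      \sum_(j < n) tens (mulR (dymon j c) << r >>) (xi (inr j) (inr i) o).

Definition actP c i : MM -> MM := lext (actPb c i).
Definition actD c i : MM -> MM := lext (actDb c i).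

(* V(theta_q) : the elements of R (x) Omega^q(Vdual) (x) F_E *)
Definition Vq (q : nat) (v : MM) : Prop :=
  forall b, b \in msupp v -> omdeg b.2 = q.

(* g-submodules (g = W(m,n) is spanned by the f d_i, f D_i, f monomials) *)
Definition IsSubmod (P : MM -> Prop) : Prop :=
  [/\ P 0, (forall u v, P u -> P v -> P (u + v)),
      (forall (a : F) v, P v -> P (a *: v)),
      (forall c i v, P v -> P (actP c i v)) &
      (forall c i v, P v -> P (actD c i v))].

Inductive Gen (X : MM -> Prop) : MM -> Prop :=
| Gen_base v : X v -> Gen X v
| Gen_zero : Gen X 0
| Gen_add u v : Gen X u -> Gen X v -> Gen X (u + v)
| Gen_scale (a : F) v : Gen X v -> Gen X (a *: v)
| Gen_actP c i v : Gen X v -> Gen X (actP c i v)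
| Gen_actD c i v : Gen X v -> Gen X (actD c i v).

(* L(theta_q) = U(g) (1 (x) L^0(theta_q)) *)
Definition rone : Rmon := ([ffun => 0%N], set0).
Definition Lq (q : nat) : MM -> Prop :=
  Gen (fun v => exists o : OmMon, omdeg o = q /\ v = << (rone, o) >>).

Definition IsHom (q q' : nat) (d : MM -> MM) : Prop :=
  [/\ (forall v, Vq q v -> Vq q' (d v)),
      (forall (a : F) u v, Vq q u -> Vq q v -> d (a *: u + v) = a *: d u + d v),
      (forall c i v, Vq q v -> d (actP c i v) = actP c i (d v)) &
      (forall c i v, Vq q v -> d (actD c i v) = actD c i (d v))].

Definition ModIso (P Q : MM -> Prop) : Prop :=
  exists phi : MM -> MM,
  [/\ (forall v, P v -> Q (phi v)),
      (forall (a : F) u v, P u -> P v -> phi (a *: u + v) = a *: phi u + phi v),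
      (forall u v, P u -> P v -> phi u = phi v -> u = v) &
      (forall w, Q w -> exists2 v, P v & phi v = w)]
  /\ (forall c i v, P v -> phi (actP c i v) = actP c i (phi v))
  /\ (forall c i v, P v -> phi (actD c i v) = actD c i (phi v)).

Definition Reducible (q : nat) : Prop :=
  exists P : MM -> Prop,
  [/\ IsSubmod P, (forall v, P v -> Vq q v),
      (exists2 v, P v & v <> 0) & (exists2 v, Vq q v & ~ P v)].

Definition elast (q : nat) : {ffun 'I_n -> nat} :=
  [ffun s : 'I_n => if val s == n.-1 then q else 0%N].
Definition genq (q : nat) : MM :=
  << (([ffun => 0%N], [set s : 'I_n | val s == n.-1]), (set0, elast q)) >>.
Definition tgtq (q : nat) : MM := << (rone, (set0, elast q.-1)) >>.

Definition IsDiffFamily (d : nat -> MM -> MM) : Prop :=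
  (forall q, (1 <= q)%N -> IsHom q q.-1 (d q) /\ d q (genq q) = tgtq q)
  /\ (forall v, Vq 0 v -> d 0%N v = 0).

Definition KerD (d : nat -> MM -> MM) (q : nat) (v : MM) : Prop :=
  Vq q v /\ d q v = 0.
Definition ImD (d : nat -> MM -> MM) (q : nat) (v : MM) : Prop :=
  exists2 w, Vq q w & v = d q w.

Definition zvec : MM := << (([ffun => 0%N], setT), (setT, [ffun => 0%N])) >>.

End WmnModules.

(* Main.v *)
Require Import Defs.
From HB Require Import structures.
From mathcomp Require Import all_boot all_order all_algebra.
From mathcomp Require Import finmap.
From mathcomp.multinomials Require Import monalg.
From mathcomp Require Import zify ring.
Set Implicit Arguments. Unset Strict Implicit. Unset Printing Implicit Defensive.
Import GRing.Theory.
Local Open Scope ring_scope.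

(* The e*_k transform like the vector fields d_i and D_s, so V(theta_q) is
   the space of q-polyvector fields with values in the Berezinian module, and d_q is,
   up to the factor -1/q, the divergence [div] = sum_k P_k (x) iota_k, where iota_k is
   contraction by e_k and P_k is the partial derivative on R (twisted by parity for
   odd k). Cartan's formula holds: f d_k acts as the anticommutator of [div] with
   "multiply by f and wedge with e*_k". This gives equivariance, and shows that vector
   fields send closed elements to exact ones. The signed combination of Euler fields
   sum_i x_i d_i - sum_s y_s D_s is therefore null-homotopic; it is diagonal with
   eigenvalue [wt], a natural number vanishing only on the class
   y_1...y_n (x) e*_1...e*_m, which yields the homology. Finally y_n (x) (e*_{m+n})^q
   generates V(theta_q), which makes d_q unique and identifies Im d_{q+1} with
   L(theta_q). *)

(** * Linear extension from a basis *)

(** The obstacle is the bookkeeping of signs. [tens] is an ordinary tensor product without a Koszul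
    rule, so parities are built into the factors: [Rp] carries the parity of the polynomial factor,
    [ehat] that of the odd letters. With these twists the derivatives on R commute up to
    [koszul k l] and the contractions up to its negative, which alone makes the square of the
    divergence vanish; and the wedges anticommute with the contractions up to a signed identity on
    the diagonal, which alone gives Cartan's formula. Both arguments are carried out on abstract
    spaces. The weight of 1_E is what makes the formula exact: its character equals the diagonal
    scalar left by that anticommutator. Characteristic 0 serves to invert 2, the degree q and the
    nonzero weights. *)

Section LinearExtension.
Variables (F : fieldType) (K : choiceType) (V : lmodType F).

Lemma lextEw (h : K -> V) (d : {fset K}) (v : {malg F[K]}) :
  (msupp v `<=` d)%fset -> lext h v = \sum_(k <- d) v@_k *: h k.
Proof.
move=> le; rewrite /lext; apply/big_fset_incl => // k _ /mcoeff_outdom ->.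
by rewrite scale0r.
Qed.

Lemma lext_is_linear (h : K -> V) : linear (lext h).
Proof.
move=> a u v; pose d := (msupp (a *: u + v) `|` (msupp u `|` msupp v))%fset.
rewrite !(@lextEw h d); first last.
- exact: fsubsetUl.
- by apply: fsubset_trans (fsubsetUr _ _); apply: fsubsetUl.
- by apply: fsubset_trans (fsubsetUr _ _); apply: fsubsetUr.
rewrite scaler_sumr -big_split; apply: eq_bigr => k _ /=.
by rewrite mcoeffD mcoeffZ scalerDl scalerA.
Qed.

HB.instance Definition _ (h : K -> V) :=
  GRing.isLinear.Build F {malg F[K]} V *:%R (lext h) (lext_is_linear h).

Lemma lextU (h : K -> V) k : lext h << k >> = h k.
Proof. by rewrite /lext msuppU oner_eq0 big_seq_fset1 mcoeffUU scale1r. Qed.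

Lemma lext0 (h : K -> V) : lext h 0 = 0.
Proof. exact: linear0. Qed.

Lemma lextZU (h : K -> V) a k : lext h (a *: << k >>) = a *: h k.
Proof. by rewrite linearZ /= lextU. Qed.

Lemma malgU1E (v : {malg F[K]}) : v = \sum_(k <- msupp v) v@_k *: << k >>.
Proof.
rewrite {1}[v]monalgE; apply: eq_bigr => k _.
by apply/malgP => k0; rewrite mcoeffZ !mcoeffU mulrnAr mulr1.
Qed.

Lemma linear_lext (f : {linear {malg F[K]} -> V}) v :
  f v = lext (fun k => f << k >>) v.
Proof. by rewrite {1}[v]malgU1E linear_sum; apply: eq_bigr => k _; rewrite linearZ. Qed.

Lemma eq_lext (h1 h2 : K -> V) v : h1 =1 h2 -> lext h1 v = lext h2 v.
Proof. by move=> eqh; apply: eq_bigr => k _; rewrite eqh. Qed.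

Lemma lext_comp (W : lmodType F) (f : {linear V -> W}) (h : K -> V) v :
  f (lext h v) = lext (fun k => f (h k)) v.
Proof. by rewrite linear_sum; apply: eq_bigr => k _; rewrite linearZ. Qed.

Lemma lextD (h1 h2 : K -> V) v :
  lext (fun k => h1 k + h2 k) v = lext h1 v + lext h2 v.
Proof. by rewrite -big_split; apply: eq_bigr => k _; rewrite scalerDr. Qed.

Lemma lextZ a (h : K -> V) v : lext (fun k => a *: h k) v = a *: lext h v.
Proof.
by rewrite scaler_sumr; apply: eq_bigr => k _; rewrite !scalerA mulrC.
Qed.

Lemma lext_sum (I : Type) (r : seq I) (h : I -> K -> V) v :
  lext (fun k => \sum_(i <- r) h i k) v = \sum_(i <- r) lext (h i) v.
Proof.
by rewrite exchange_big; apply: eq_bigr => k _; rewrite scaler_sumr.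
Qed.

Lemma msupp_ind (P : V -> Prop) (h : K -> V) v :
  P 0 -> (forall u w, P u -> P w -> P (u + w)) ->
  (forall a u, P u -> P (a *: u)) ->
  (forall k, k \in msupp v -> P (h k)) -> P (lext h v).
Proof.
move=> P0 PD PZ Ph; rewrite /lext big_seq.
by apply: big_ind => // k kv; apply: PZ; apply: Ph.
Qed.

Lemma lext_coef (K' : choiceType) (h : K -> {malg F[K']}) v k' :
  (lext h v)@_k' = \sum_(k <- msupp v) v@_k * (h k)@_k'.
Proof. by rewrite raddf_sum; apply: eq_bigr => k _; rewrite /= mcoeffZ. Qed.

Lemma lext_diag_coef (phi : K -> F) (v : {malg F[K]}) b :
  (lext (fun k => phi k *: << k >>) v)@_b = phi b * v@_b.
Proof.
rewrite [LHS]lext_coef; have [bv|bv] := boolP (b \in msupp v); last first.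
  rewrite (mcoeff_outdom bv) mulr0 big_seq big1 // => b' b'v.
  rewrite mcoeffZ mcoeffU; case: eqP => [e|_]; last by rewrite !mulr0.
  by rewrite -e b'v in bv.
rewrite (big_fsetD1 b) //= mcoeffZ mcoeffUU mulr1 mulrC big_seq big1 ?addr0 // => b'.
by rewrite !inE => /andP[/negPf ne _]; rewrite mcoeffZ mcoeffU ne !mulr0.
Qed.

End LinearExtension.

(* Every operator below sends a basis vector to a multiple of a basis vector. *)
Definition mono (F : fieldType) (K : choiceType) (c : K -> F) (f : K -> K) k :
  {malg F[K]} := c k *: << f k >>.

Lemma lext_mono (F : fieldType) (K : choiceType) (c d : K -> F) (f g : K -> K) k :
  lext (mono c f) (mono d g k) = (d k * c (g k)) *: << f (g k) >>.
Proof. by rewrite /mono lextZU scalerA. Qed.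

(** Basis vectors need to agree only when the coefficient is nonzero: truncated subtraction of
    exponents and removal of absent indices give meaningless monomials, always with coefficient
    0. *)
Lemma eq_scaleU (F : fieldType) (K : choiceType) (a b : F) (k k' : K) :
  a = b -> (a != 0 -> k = k') -> a *: << k >> = b *: << k' >> :> {malg F[K]}.
Proof.
by move=> <- e; have [->|/e->//] := eqVneq a 0; rewrite !scale0r.
Qed.

Lemma eq_scaleUD (F : fieldType) (K : choiceType) (a b c : F) (k0 k k1 k2 : K) :
  a = b + c -> (a != 0 -> k = k0) -> (b != 0 -> k1 = k0) -> (c != 0 -> k2 = k0) ->
  a *: << k >> = b *: << k1 >> + c *: << k2 >> :> {malg F[K]}.
Proof.
move=> e ea eb ec; rewrite (@eq_scaleU _ _ a a k k0) // (@eq_scaleU _ _ b b k1 k0) //.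
by rewrite (@eq_scaleU _ _ c c k2 k0) // e scalerDl.
Qed.

Lemma mono_swap (F : fieldType) (K : choiceType) (c d : K -> F) (f g : K -> K) a k :
  d k * c (g k) = a * (c k * d (f k)) -> (d k * c (g k) != 0 -> f (g k) = g (f k)) ->
  lext (mono c f) (mono d g k) = a *: lext (mono d g) (mono c f k).
Proof. by move=> e1 e2; rewrite !lext_mono scalerA; apply: eq_scaleU. Qed.

Lemma mono_swapD (F : fieldType) (K : choiceType) (c d : K -> F) (f g : K -> K)
    (a b : F) k0 k :
  d k * c (g k) = a * (c k * d (f k)) + b ->
  (d k * c (g k) != 0 -> f (g k) = k0) ->
  (a * (c k * d (f k)) != 0 -> g (f k) = k0) -> (b != 0 -> k = k0) ->
  lext (mono c f) (mono d g k) = a *: lext (mono d g) (mono c f k) + b *: << k >>.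
Proof.
by move=> e1 e2 e3 e4; rewrite !lext_mono scalerA; apply: (eq_scaleUD e1 e2 e3 e4).
Qed.

Lemma mono_comm (F : fieldType) (K : choiceType) (c d : K -> F) (f g : K -> K)
    (b : F) k0 k k' :
  d k * c (g k) = c k * d (f k) + b ->
  (d k * c (g k) != 0 -> f (g k) = k0) ->
  (c k * d (f k) != 0 -> g (f k) = k0) -> (b != 0 -> k' = k0) ->
  lext (mono c f) (mono d g k) = lext (mono d g) (mono c f k) + b *: << k' >>.
Proof.
by move=> e1 e2 e3 e4; rewrite !lext_mono; apply: (eq_scaleUD e1 e2 e3 e4).
Qed.

Lemma lext_id (F : fieldType) (K : choiceType) (v : {malg F[K]}) :
  lext (fun k => << k >>) v = v.
Proof. by rewrite {2}[v]malgU1E. Qed.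

Lemma lext_swap (F : fieldType) (K : choiceType) (A B : K -> {malg F[K]}) a :
  (forall k, lext A (B k) = a *: lext B (A k)) ->
  forall v, lext A (lext B v) = a *: lext B (lext A v).
Proof.
move=> e v; rewrite [LHS]lext_comp (eq_lext _ e) lextZ.
by rewrite (lext_comp (lext B) A v).
Qed.

Lemma lext_swapD (F : fieldType) (K : choiceType) (A B : K -> {malg F[K]}) a b :
  (forall k, lext A (B k) = a *: lext B (A k) + b *: << k >>) ->
  forall v, lext A (lext B v) = a *: lext B (lext A v) + b *: v.
Proof.
move=> e v; rewrite [LHS]lext_comp (eq_lext _ e) lextD !lextZ lext_id.
by rewrite (lext_comp (lext B) A v).
Qed.

Lemma bilextEl (F : fieldType) (K1 K2 : choiceType) (V : lmodType F)
    (h : K1 -> K2 -> V) u v : bilext h u v = lext (fun k1 => lext (h k1) v) u.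
Proof.
apply: eq_bigr => k1 _; rewrite scaler_sumr.
by apply: eq_bigr => k2 _; rewrite scalerA.
Qed.

Lemma bilextEr (F : fieldType) (K1 K2 : choiceType) (V : lmodType F)
    (h : K1 -> K2 -> V) u v : bilext h u v = lext (fun k2 => lext (h^~ k2) u) v.
Proof.
rewrite /bilext exchange_big; apply: eq_bigr => k2 _; rewrite scaler_sumr.
by apply: eq_bigr => k1 _; rewrite scalerA mulrC.
Qed.

(** * Tensor products and factorwise operators *)

Section Tensors.
Variables (F : fieldType) (m n : nat).
Notation RR := (RR F m n).
Notation L0 := (L0 F m n).
Notation MM := (MM F m n).
Implicit Types (u : RR) (v : L0).

Lemma tens_is_linear u : linear (tens u).
Proof. by move=> a v w; rewrite /tens !bilextEr linearP. Qed.
HB.instance Definition _ u :=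
  GRing.isLinear.Build F L0 MM *:%R (tens u) (tens_is_linear u).

Definition tensr v u := tens u v.
Lemma tensr_is_linear v : linear (tensr v).
Proof. by move=> a u w; rewrite /tensr /tens !bilextEl linearP. Qed.
HB.instance Definition _ v :=
  GRing.isLinear.Build F RR MM *:%R (tensr v) (tensr_is_linear v).

Lemma tensDl u u' v : tens (u + u') v = tens u v + tens u' v.
Proof. exact: (linearD (tensr v)). Qed.
Lemma tensZl a u v : tens (a *: u) v = a *: tens u v.
Proof. exact: (linearZ_LR (tensr v)). Qed.
Lemma tensUU r o : tens << r >> << o >> = << (r, o) >> :> MM.
Proof. by rewrite /tens bilextEl !lextU. Qed.

Lemma tens_scaled a b c e u v :
  a * b * c = e -> a *: tens (b *: u) (c *: v) = e *: tens u v.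
Proof.
move=> <-; apply: (etrans (congr1 (fun w => a *: w) (tensZl b u (c *: v)))).
have -> : tens u (c *: v) = c *: tens u v by exact: linearZ_LR.
by move: (tens u v) => w; rewrite -[RHS]scalerA -[RHS]scalerA.
Qed.

Lemma mulRUl c u : mulR << c >> u = lext (mulmon F c) u.
Proof. by rewrite /mulR bilextEl lextU. Qed.
Lemma mulRUr u r : mulR u << r >> = lext (fun c => mulmon F c r) u.
Proof. by rewrite /mulR bilextEr lextU. Qed.

(** No Koszul sign passes between the factors; such signs have to be absorbed in [A] or [B], and in
    exchange composites are computed factorwise. *)
Definition tens_op (A : Rmon m n -> RR) (B : OmMon m n -> L0) : MM -> MM :=
  lext (fun b => tens (A b.1) (B b.2)).
HB.instance Definition _ A B := GRing.Linear.copy (tens_op A B)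
  (lext (fun b => tens (A b.1) (B b.2))).

Lemma tens_opU A B r o : tens_op A B << (r, o) >> = tens (A r) (B o).
Proof. by rewrite /tens_op lextU. Qed.

Lemma tens_op_tens A B u v : tens_op A B (tens u v) = tens (lext A u) (lext B v).
Proof.
have E1 w : tens (lext A u) w = lext (fun r => tens (A r) w) u.
  exact: (lext_comp (tensr w)).
have E2 r : tens (A r) (lext B v) = lext (fun o => tens (A r) (B o)) v.
  exact: lext_comp.
rewrite E1 {1}/tens bilextEl lext_comp; apply: eq_lext => r.
by rewrite E2 lext_comp; apply: eq_lext => o; rewrite /= tens_opU.
Qed.

End Tensors.

(* Conversion between closed elements of {malg F[K]} blows up, which is also why the
   concrete identities below are chained with [etrans] rather than rewritten. *)
Opaque lext tens mulR.

(** * Operators on the super-Grassmann algebra *)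

(** The source of anticommutation signs: exactly one of [i < j] and [j < i] holds, so exchanging two
    removals or insertions shifts the count of smaller elements by one. *)
Lemma odd_swap (i j a : nat) : i <> j -> odd ((i < j) + a) = odd ((j < i) + a).+1.
Proof. by case: (ltngtP i j) => //= _ _; rewrite negbK. Qed.

Section Signs.
Variable F : fieldType.

Lemma sgnM a b : sgn F a * sgn F b = sgn F (a + b).
Proof. by rewrite /sgn exprD. Qed.
Lemma sgnN a : - sgn F a = sgn F a.+1.
Proof. by rewrite /sgn exprS mulN1r. Qed.
Lemma sgn_odd a b : odd a = odd b -> sgn F a = sgn F b.
Proof. by move=> e; rewrite /sgn -signr_odd e signr_odd. Qed.
Lemma sgn0 : sgn F 0 = 1. Proof. by []. Qed.

Definition cnt p (S : {set 'I_p}) (j : 'I_p) := #|[set s in S | (s < j)%N]|.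

Lemma cnt_sum p (S : {set 'I_p}) j : cnt S j = (\sum_(s in S) (s < j))%N.
Proof.
rewrite /cnt -sum1_card [RHS]big_mkcond [LHS]big_mkcond.
by apply: eq_bigr => s _; rewrite inE; case: (_ \in _); case: (_ < _)%N.
Qed.

Lemma cntU p (S : {set 'I_p}) i j :
  i \notin S -> cnt (i |: S) j = ((i < j) + cnt S j)%N.
Proof. by move=> iS; rewrite !cnt_sum big_setU1. Qed.

Lemma cntD p (S : {set 'I_p}) i j :
  i \in S -> cnt S j = ((i < j) + cnt (S :\ i) j)%N.
Proof. by move=> iS; rewrite !cnt_sum (big_setD1 i). Qed.

End Signs.

Section OmegaOperators.
Variables (F : fieldType) (m n : nat).
Notation L0 := (L0 F m n).
Notation OmMon := (OmMon m n).
Notation idx := (idx m n).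
Implicit Types (o : OmMon) (k l : idx).

Definition binc (s : 'I_n) (b : {ffun 'I_n -> nat}) := [ffun t => b t + (t == s)]%N.
Definition bdec (s : 'I_n) (b : {ffun 'I_n -> nat}) := [ffun t => b t - (t == s)]%N.

(** Left multiplication by e*_k on ordered monomials. The sign moves the new letter to its place: an
    even letter passes the smaller even ones; an odd letter passes all even ones and commutes with
    the odd ones. *)
Definition omec k o : F :=
  match k with
  | inl i => (i \notin o.1)%:R * sgn F (cnt o.1 i)
  | inr s => sgn F #|o.1|
  end.
Definition omef k o : OmMon :=
  match k with inl i => (i |: o.1, o.2) | inr s => (o.1, binc s o.2) end.
(** Contraction by e_k, with the sign of bringing e*_k to the front; on an odd letter it
    differentiates a power, whence the exponent as a factor. *)
Definition omic k o : F :=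
  match k with
  | inl i => (i \in o.1)%:R * sgn F (cnt o.1 i)
  | inr s => (o.2 s)%:R * sgn F #|o.1|
  end.
Definition omif k o : OmMon :=
  match k with inl i => (o.1 :\ i, o.2) | inr s => (o.1, bdec s o.2) end.
Definition ome k := mono (omec k) (omef k).
Definition omi k := mono (omic k) (omif k).

(* The generators obey [v w = - koszul v w *: w v]. *)
Definition koszul k l : F := sgn F (ipar k * ipar l).

Lemma binc_bdec s t b : s != t -> binc s (bdec t b) = bdec t (binc s b).
Proof.
move=> st; apply/ffunP => u; rewrite !ffunE.
by case: (eqVneq u s) => [->|_]; rewrite ?(negPf st) ?addn0 ?subn0.
Qed.
Lemma binc_bdec_pos s (b : {ffun _}) : (0 < b s)%N -> binc s (bdec s b) = b.
Proof.
move=> bs; apply/ffunP => u; rewrite !ffunE.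
by case: eqP => [->|_]; rewrite ?subn0 ?addn0 ?subnK.
Qed.
Lemma bdec_binc s b : bdec s (binc s b) = b.
Proof. by apply/ffunP => u; rewrite !ffunE addnK. Qed.
Lemma bincC s t b : binc s (binc t b) = binc t (binc s b).
Proof. by apply/ffunP => u; rewrite !ffunE addnAC. Qed.
Lemma bdecC s t b : bdec s (bdec t b) = bdec t (bdec s b).
Proof. by apply/ffunP => u; rewrite !ffunE subnAC. Qed.

Lemma ord_neq p (i j : 'I_p) : i != j -> (i : nat) <> j.
Proof. by move=> ne e; case/eqP: ne; apply: val_inj. Qed.

Lemma sgn_sqr a : sgn F a * sgn F a = 1.
Proof. by rewrite sgnM addnn; apply: (@sgn_odd _ _ 0); rewrite odd_double. Qed.

Lemma omi_omi k l o : lext (omi k) (omi l o) = - koszul k l *: lext (omi l) (omi k o).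
Proof.
apply: mono_swap => [|_]; last first.
  case: k l => [i|s] [j|t] //=; last by rewrite bdecC.
  by rewrite setDDl setUC -setDDl.
case: o => T b; case: k => [i|s]; case: l => [j|t]; rewrite /koszul /= ?inE ?sgn0.
- have [->|ij] := eqVneq i j; first by rewrite ?eqxx /=; ring.
  rewrite /=.
  case: (boolP (j \in T)) => jT; case: (boolP (i \in T)) => iT /=; try ring.
  rewrite !mul1r mulN1r !sgnM sgnN; apply: sgn_odd.
  rewrite (cntD j iT) (cntD i jT) -!addnA [RHS]/= [(cnt (T :\ j) i + _)%N]addnC.
  exact/odd_swap/ord_neq.
- case: (boolP (i \in T)) => iT /=; last by ring.
  rewrite (cardsD1 i T) iT -sgnM /sgn; ring.
- case: (boolP (j \in T)) => jT /=; last by ring.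
  rewrite (cardsD1 j T) jT -sgnM /sgn; ring.
- rewrite !ffunE; have [->|st] := eqVneq s t; first by rewrite ?eqxx /sgn; ring.
  by rewrite !subn0 /sgn; ring.
Qed.

(** Contraction is a superderivation: it passes e*_l with sign [- koszul k l] and leaves the pairing
    of e_k with e*_l. *)
Lemma omi_ome k l o : lext (omi k) (ome l o) =
  - koszul k l *: lext (ome l) (omi k o) + (k == l)%:R *: << o >>.
Proof.
have [<-|kl] := eqVneq k l.
  case: o k => T b [i|s]; rewrite /koszul /=.
    apply: (@mono_swapD _ _ _ _ _ _ _ _ (T, b)); rewrite /= ?inE ?ffunE ?eqxx /=.
    - case: (boolP (i \in T)) => iT /=.
        by rewrite (cntD i iT) ltnn add0n /sgn !mul1r !mul0r -expr2 sqrr_sign; ring.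
      by rewrite (cntU i iT) ltnn /sgn !mul1r !mul0r -expr2 sqrr_sign; ring.
    - by case: (boolP (i \in T)) => iT; rewrite /= ?mul0r ?eqxx // setU1K.
    - by case: (boolP (i \in T)) => iT; rewrite /= ?mul0r ?mulr0 ?eqxx // setD1K.
    - by [].
  apply: (@mono_swapD _ _ _ _ _ _ _ _ (T, b)); rewrite /= ?inE ?ffunE ?eqxx /=.
  - by rewrite natrD muln1 /(sgn F 1) expr1 opprK mul1r mulrCA -[in RHS]mulrA !sgn_sqr !mulr1.
  - by rewrite bdec_binc.
  - case: (posnP (b s)) => [->|bs]; last by rewrite binc_bdec_pos.
    by rewrite !(mul0r, mulr0) eqxx.
  - by [].
rewrite scale0r addr0; apply: mono_swap => [|_]; last first.
  case: k l kl => [i|s] [j|t] //= kl; last first.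
    by rewrite binc_bdec //; apply: contraNneq kl => ->.
  congr (_, _); apply/setP => x; rewrite !inE; case: eqVneq => // ->.
  by case: eqVneq => // e; rewrite e eqxx in kl.
case: o => T b; case: k l kl => [i|s] [j|t] /= kl; rewrite /koszul /= ?inE ?sgn0.
- have ij : i != j by apply: contraNneq kl => ->.
  rewrite (eq_sym j i) (negPf ij) /=.
  case: (boolP (j \in T)) => jT; case: (boolP (i \in T)) => iT /=; try ring.
  rewrite !mul1r mulN1r !sgnM sgnN; apply: sgn_odd.
  rewrite cntU // (cntD j iT); move: (ord_neq ij).
  by case: ltngtP => //= _ _; rewrite ?add0n ?add1n ?addSn ?addnS addnC.
- case: (boolP (i \in T)) => iT /=; last by ring.
  by rewrite (cardsD1 i T) iT -sgnM /sgn; ring.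
- case: (boolP (j \in T)) => jT /=; first by ring.
  by rewrite cardsU1 jT -sgnM /sgn; ring.
- have st : s != t by apply: contraNneq kl => ->.
  by rewrite !ffunE (negPf st) addn0 /sgn; ring.
Qed.

Lemma ome_ome k l o : lext (ome k) (ome l o) = - koszul k l *: lext (ome l) (ome k o).
Proof.
apply: mono_swap => [|_]; last first.
  by case: k l => [i|s] [j|t] //=; [rewrite setUCA | rewrite bincC].
case: o => T b; case: k => [i|s]; case: l => [j|t]; rewrite /koszul /= ?inE ?sgn0.
- have [->|ij] := eqVneq i j; first by rewrite ?eqxx /=; ring.
  rewrite /=.
  case: (boolP (j \in T)) => jT; case: (boolP (i \in T)) => iT /=; try ring.
  rewrite !mul1r mulN1r !sgnM sgnN; apply: sgn_odd.
  rewrite !cntU // addnCA [in RHS]addnCA [(cnt T i + _)%N in RHS]addnC.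
  by apply/odd_swap/ord_neq; rewrite // eq_sym.
- case: (boolP (i \in T)) => iT /=; first by ring.
  by rewrite cardsU1 iT -sgnM /sgn; ring.
- case: (boolP (j \in T)) => jT /=; first by ring.
  by rewrite cardsU1 jT -sgnM /sgn; ring.
- by rewrite /sgn; ring.
Qed.

Lemma omiE k o : omi k o = omic k o *: << omif k o >>. Proof. by []. Qed.
Lemma omeE k o : ome k o = omec k o *: << omef k o >>. Proof. by []. Qed.

End OmegaOperators.

Opaque omi ome.

(** * The action of gl(m|n) on words *)

Section AbstractWords.
Variables (F : fieldType) (m n : nat) (L : lmodType F).
Notation idx := (idx m n).
Variables (e i : idx -> {linear L -> L}) (P : seq idx -> L).
Hypothesis P_cons : forall x w, P (x :: w) = e x (P w).
Hypothesis P_nil : forall k, i k (P [::]) = 0.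
Hypothesis ie : forall k l v, i k (e l v) = - koszul F k l *: e l (i k v) + (k == l)%:R *: v.
Hypothesis ee : forall k l v, e k (e l v) = - koszul F k l *: e l (e k v).

(** Induction on the word. Moving [i k] and then [e l] past the first letter x costs
    (-1)^{(|k|+|l|)|x|}, the share of x in the sign attached to prefixes; the pairing term of [ie]
    is the substitution at the first letter itself. *)
Lemma sum_substitutions k l (w : seq idx) :
  \sum_(t < size w) (if nth l w t == k then
     sgn F ((ipar k + ipar l) * nodd (take t w)) *: P (set_nth l w t l) else 0)
  = e l (i k (P w)).
Proof.
elim: w => [|x w IH]; first by rewrite big_ord0 P_nil linear0.
rewrite P_cons ie linearD !linearZ /= ee -IH big_ord_recl /= addrC; congr (_ + _).
  rewrite scalerA linear_sum scaler_sumr; apply: eq_bigr => t _ /=.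
  case: ifP => _; last by rewrite linear0 scaler0.
  rewrite linearZ /= -P_cons scalerA; congr (_ *: _).
  rewrite /koszul mulrNN !sgnM; congr sgn.
  by rewrite -mulnDl -mulnDr; case: x.
rewrite [k == x]eq_sym; case: eqP => _; rewrite ?scale0r // muln0.
by rewrite P_cons.
Qed.

Lemma scaled_sum_substitutions a k l (w : seq idx) :
  \sum_(t < size w) (if nth l w t == k then
     (sgn F ((ipar k + ipar l) * nodd (take t w)) * a) *: P (set_nth l w t l) else 0)
  = a *: e l (i k (P w)).
Proof.
rewrite -sum_substitutions scaler_sumr; apply: eq_bigr => t _.
by case: ifP => _; rewrite ?scaler0 // scalerA mulrC.
Qed.

End AbstractWords.

Section WordsAndXi.
Variables (F : fieldType) (m n : nat).
Notation L0 := (L0 F m n).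
Notation OmMon := (OmMon m n).
Notation idx := (idx m n).
Implicit Types (o : OmMon) (k l x : idx) (w : seq idx).

Lemma count_lt_evens i w : uniq (evens w) ->
  count (fun y => idx_lt y (inl i : idx)) w = cnt [set j in evens w] i.
Proof.
move=> uw; rewrite cnt_sum (eq_bigl (mem (evens w))); last by move=> j; rewrite !inE.
rewrite -big_uniq // {uw}; elim: w => [|[j|t] w IH] /=; first by rewrite big_nil.
  by rewrite big_cons IH.
by rewrite IH.
Qed.

Lemma count_lt_odd s w : uniq (evens w) ->
  count (fun y => idx_lt y (inr s : idx)) w = #|[set j in evens w]|.
Proof.
move=> uw; have -> : #|[set j in evens w]| = size (evens w).
  by rewrite -(card_uniqP uw); apply: eq_card => j; rewrite inE.
by elim: w {uw} => [|[j|t] w IH] //=; rewrite IH.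
Qed.

(** The inversions of [x :: w] that involve [x] make up the sign in [ome], and a repeated even
    letter kills both sides. The product of a word is thus an iterated wedge, as [sum_substitutions]
    requires. *)
Lemma omprod_cons x w : omprod F (x :: w) = lext (ome F x) (omprod F w).
Proof.
rewrite /omprod; case: x => [i|s] /=.
  case: (boolP (uniq (evens w))) => uw; last by rewrite andbF lext0.
  rewrite andbT lextZU omeE scalerA count_lt_evens //= inE.
  case: (boolP (i \in evens w)) => iw /=; first by rewrite mul0r mulr0 scale0r.
  rewrite mul1r sgnM addnC; apply: eq_scaleU => // _.
  by congr (_, _); apply/setP => j; rewrite !inE.
case: (boolP (uniq (evens w))) => uw; last by rewrite lext0.
rewrite count_lt_odd // lextZU omeE scalerA /= sgnM addnC.
apply: eq_scaleU => // _; congr (_, _).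
by apply/ffunP => t; rewrite !ffunE addnC eq_sym.
Qed.

Lemma evens_cat w1 w2 : evens (w1 ++ w2) = evens w1 ++ evens w2.
Proof. exact: pmap_cat. Qed.

Lemma evens_omword o : evens (omword o) = enum o.1.
Proof.
rewrite /omword evens_cat; have -> : evens [seq (inl i : idx) | i <- enum o.1] = enum o.1.
  by elim: (enum o.1) => //= i s ->.
rewrite (_ : evens _ = [::]) ?cats0 //.
elim: (enum 'I_n) => //= s ss IH; rewrite evens_cat {}IH cats0.
by elim: (o.2 s) => //= p ->.
Qed.

Lemma count_omword o s : count_mem (inr s : idx) (omword o) = o.2 s.
Proof.
rewrite /omword count_cat (_ : count_mem _ _ = 0%N) ?add0n; last first.
  by elim: (enum o.1).
rewrite count_flatten -map_comp.
have [u sn] : uniq (enum 'I_n) /\ s \in enum 'I_n by rewrite enum_uniq mem_enum.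
elim: (enum 'I_n) u sn => //= t ss IH /andP[tss /IH{}IH]; rewrite inE count_nseq /=.
have -> : (inr t == inr s :> idx) = (t == s) by [].
have [<-|ts] := eqVneq t s.
  rewrite mul1n => _; rewrite [sumn _](_ : _ = 0%N) ?addn0 //.
  elim: ss tss {IH} => //= t' ss IH; rewrite inE negb_or => /andP[tt' /IH ->].
  by rewrite addn0 count_nseq /= (_ : (_ == _) = false) //; apply/eqP => -[/esym/eqP]; apply/negP.
by rewrite /= mul0n add0n.
Qed.

Lemma winv_pairwise w : pairwise (fun x y => ~~ idx_lt y x) w -> winv w = 0%N.
Proof.
elim: w => //= x w IH /andP[xw /IH ->]; rewrite addn0.
by apply/eqP; rewrite -leqn0 leqNgt -has_count -all_predC.
Qed.

(** [idx_lt] never holds between two odd letters, which commute, so only the increasing order of the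
    even letters and their place in front matter. *)
Lemma winv_omword o : winv (omword o) = 0%N.
Proof.
apply: winv_pairwise; rewrite /omword pairwise_cat; apply/and3P; split.
- by apply/allrelP => x y /mapP[i _ ->] /flatten_mapP[s _ /nseqP[-> _]].
- rewrite pairwise_map; have: sorted ltn [seq val i | i <- enum o.1].
    apply: (subseq_sorted ltn_trans _ (iota_ltn_sorted 0 m)).
    by rewrite -val_enum_ord; apply/map_subseq; rewrite {1}/enum_mem -enumT; apply: filter_subseq.
  rewrite sorted_pairwise; last exact: ltn_trans.
  rewrite pairwise_map; apply: sub_pairwise => i j /= ij.
  by rewrite -leqNgt ltnW.
- elim: (enum 'I_n) => //= s ss IH; rewrite pairwise_cat IH andbT; apply/andP; split.
    by apply/allrelP => x y /nseqP[-> _] /flatten_mapP[t _ /nseqP[-> _]].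
  elim: (o.2 s) => //= p ->; rewrite andbT; apply/allP => y /nseqP[-> _] //.
Qed.

Lemma omprod_omword o : omprod F (omword o) = << o >>.
Proof.
rewrite /omprod winv_omword evens_omword enum_uniq scale1r; congr << _ >>.
case: o => T b; congr (_, _); first by apply/setP => i; rewrite inE mem_enum.
by apply/ffunP => s; rewrite ffunE count_omword.
Qed.

Lemma omi_nil k : lext (omi F k) (omprod F [::]) = 0.
Proof.
rewrite lextZU (_ : omi F k _ = 0) ?scaler0 // omiE.
rewrite (_ : omic F k _ = 0) ?scale0r //.
by case: k => [i|s] /=; rewrite ?inE ?ffunE mul0r.
Qed.

(** E_kl replaces e*_k by e*_l, which is a wedge after a contraction; the second term is the
    character of the factor 1_E. *)
Lemma xiE k l o : xi F k l o =
  - sgn F ((ipar k + ipar l) * ipar k) *: lext (ome F l) (omi F k o)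
  + (if k == l then Ecoef F k *: << o >> else 0).
Proof.
have E : lext (omi F k) (omprod F (omword o)) = omi F k o.
  by rewrite omprod_omword lextU.
have S := @scaled_sum_substitutions F m n L0
  (fun x => lext (ome F x)) (fun x => lext (omi F x))
  (@omprod F m n) omprod_cons omi_nil (fun k l => lext_swapD (@omi_ome F m n k l))
  (fun k l => lext_swap (@ome_ome F m n k l))
  (- sgn F ((ipar k + ipar l) * ipar k)) k l (omword o).
exact: (congr1 (fun v => v + _) (etrans S (congr1 (fun v => _ *: lext (ome F l) v) E))).
Qed.

End WordsAndXi.

Ltac parity := rewrite ?(oddD, oddS) /=; repeat case: (odd _) => //=.

(** * Operators on R *)

Section Inversions.
Variable p : nat.
Implicit Types (A B : {set 'I_p}) (s : 'I_p).

Definition cgt A s := (\sum_(a in A) (s < a))%N.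
(** Exponent of the sign in y^A y^B, written as a sum so that an element can be peeled off either
    set. *)
Definition invs A B := (\sum_(a in A) cnt B a)%N.

Lemma card_invs A B :
  #|[set q : 'I_p * 'I_p | (q.1 \in A) && (q.2 \in B) && (q.2 < q.1)%N]| = invs A B.
Proof.
rewrite /invs (eq_bigr (fun a : 'I_p => \sum_(b in B) (b < a)))%N; last first.
  by move=> a _; rewrite cnt_sum.
rewrite pair_big_dep /= -sum1_card [LHS]big_mkcond [RHS]big_mkcond /=.
by apply: eq_bigr => -[a b] _; rewrite inE /=; case: (a \in A); case: (b \in B); case: (b < a)%N.
Qed.

Lemma cnt_cgt A s : s \notin A -> (cnt A s + cgt A s)%N = #|A|.
Proof.
move=> sA; rewrite cnt_sum /cgt -big_split -sum1_card; apply: eq_bigr => a aA /=.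
have : (a : nat) <> s by apply/ord_neq; apply: contraNneq sA => <-.
by case: ltngtP.
Qed.

Lemma invsDl A B s : s \in A -> invs A B = (cnt B s + invs (A :\ s) B)%N.
Proof. by move=> sA; rewrite /invs (big_setD1 s). Qed.

Lemma invsDr A B s : s \in B -> invs A B = (cgt A s + invs A (B :\ s))%N.
Proof.
by move=> sB; rewrite /invs /cgt -big_split; apply: eq_bigr => a _; rewrite (cntD a sB).
Qed.

Lemma cnt_disjointU A B s : [disjoint A & B] -> cnt (A :|: B) s = (cnt A s + cnt B s)%N.
Proof. by move=> dAB; rewrite !cnt_sum -bigU //; apply: eq_bigl => i; rewrite !inE. Qed.

Lemma card_disjointU A B : [disjoint A & B] -> #|A :|: B| = (#|A| + #|B|)%N.
Proof. by move=> dAB; rewrite -!sum1_card -bigU //; apply: eq_bigl => i; rewrite !inE. Qed.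

Lemma disjointD1l A B s : s \notin B -> [disjoint A :\ s & B] = [disjoint A & B].
Proof.
move=> sB; rewrite -!setI_eq0; congr (_ == _); apply/setP => x; rewrite !inE.
by case: eqVneq => // ->; rewrite (negPf sB) !andbF.
Qed.

Lemma disjointD1r A B s : s \notin A -> [disjoint A & B :\ s] = [disjoint A & B].
Proof. by move=> sA; rewrite disjoint_sym disjointD1l // disjoint_sym. Qed.

Lemma disjointD1lr A B s : [disjoint A :\ s & B] = [disjoint A & B :\ s].
Proof.
rewrite -!setI_eq0; congr (_ == _); apply/setP => x; rewrite !inE.
by case: (x != s); case: (x \in A); case: (x \in B).
Qed.

End Inversions.

Section ROperators.
Variables (F : fieldType) (m n : nat).
Notation RR := (RR F m n).
Notation Rmon := (Rmon m n).
Notation idx := (idx m n).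
Implicit Types (c r : Rmon) (k l : idx).

(* The odd derivations are twisted by the parity of their argument, so that they
   commute with left multiplications up to [Rg]. *)
Definition Rpc k r : F :=
  match k with
  | inl i => (r.1 i)%:R
  | inr s => (s \in r.2)%:R * sgn F (cnt r.2 s + #|r.2|)
  end.
Definition Rpf k r : Rmon :=
  match k with inl i => (bdec i r.1, r.2) | inr s => (r.1, r.2 :\ s) end.
Definition Rp k : Rmon -> RR := mono (Rpc k) (Rpf k).

Definition Rmc c r : F := [disjoint c.2 & r.2]%:R * sgn F (invs c.2 r.2).
Definition Rmf c r : Rmon := ([ffun i => c.1 i + r.1 i]%N, c.2 :|: r.2).
Definition Rm c : Rmon -> RR := mono (Rmc c) (Rmf c).

(** Coefficient of the derivative of [c] times [r]. For odd k the twist is by the parity of the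
    whole product, hence both cardinals in the sign. *)
Definition Rgc k c r : F :=
  match k with
  | inl i => (c.1 i)%:R * Rmc (bdec i c.1, c.2) r
  | inr s => sgn F (#|c.2| + #|r.2|) *
             (((s \in c.2)%:R * sgn F (cnt c.2 s)) * Rmc (c.1, c.2 :\ s) r)
  end.
Definition Rg k c r : RR := Rgc k c r *: << Rmf (Rpf k c) r >>.

Lemma Rp_Rp k l r : lext (Rp k) (Rp l r) = koszul F k l *: lext (Rp l) (Rp k r).
Proof.
apply: mono_swap => [|_]; last first.
  case: k l => [i|s] [j|t] //=; first by rewrite bdecC.
  by rewrite setDDl setUC -setDDl.
case: r => a S; case: k => [i|s]; case: l => [j|t]; rewrite /koszul /= ?inE ?sgn0.
- rewrite !ffunE; have [->|ij] := eqVneq i j; first by rewrite ?eqxx; ring.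
  by rewrite !subn0; ring.
- by ring.
- by ring.
- have [->|st] := eqVneq s t; first by rewrite ?eqxx /=; ring.
  rewrite /=; case: (boolP (t \in S)) => tS; case: (boolP (s \in S)) => sS /=; try ring.
  rewrite !mul1r muln1 !sgnM; apply: sgn_odd.
  rewrite (cntD t sS) (cntD s tS) (cardsD1 s S) sS (cardsD1 t (S :\ s)).
  rewrite (cardsD1 s (S :\ t)) !inE st eq_sym st tS sS /=.
  rewrite setDDl [_ :|: _]setUC -setDDl; move: (ord_neq st); case: ltngtP => //= _ _; parity.
Qed.

Lemma Rp_Rm k c r : lext (Rp k) (Rm c r) = lext (Rm c) (Rp k r) + Rg k c r.
Proof.
case: c r => [a S] [a' S']; case: k => [i|s].
  apply: (@mono_comm _ _ _ _ _ _ _ (bdec i [ffun j => a j + a' j]%N, S :|: S')).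
  - by rewrite /= /Rmc /= ffunE natrD; ring.
  - by [].
  - move=> /= ne; congr (_, _); apply/ffunP => j; rewrite !ffunE.
    case: eqVneq => [ej|_]; last by rewrite !subn0.
    rewrite addnBA // lt0n; apply: contraNneq ne => a0.
    by rewrite -ej a0 mul0r.
  - move=> /= ne; congr (_, _); apply/ffunP => j; rewrite !ffunE.
    case: eqVneq => [ej|_]; last by rewrite !subn0.
    rewrite addnBAC // lt0n; apply: contraNneq ne => a0.
    by rewrite -ej a0 mul0r.
case: (boolP (s \in S)) => sS; case: (boolP (s \in S')) => sS'.
(* Both factors contain y_s, so the product vanishes, while the two Leibniz terms may be nonzero and
   have to cancel. *)
- have dF : [disjoint S & S'] = false.
    by apply/negP => /disjointFr/(_ sS); rewrite sS'.
  apply: (@mono_comm _ _ _ _ _ _ _ ([ffun j => a j + a' j]%N, S :|: S')) => /=.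
  + rewrite /Rmc /= dF !inE sS sS' disjointD1lr; case: [disjoint _ & _] => /=; last by ring.
    rewrite !mul0r !mul1r !sgnM; apply/esym/eqP; rewrite addr_eq0 sgnN; apply/eqP/sgn_odd.
    have sSs : s \notin S :\ s by rewrite !inE eqxx.
    have := cnt_cgt sSs; have := cntD s sS'; have := cntD s sS.
    rewrite (invsDl _ sS) (invsDr _ sS') !ltnn !add0n (cardsD1 s S) sS => -> -> <-.
    by parity.
  + by rewrite /Rmc dF !mul0r eqxx.
  + move=> _; congr (_, _); apply/setP => x; rewrite !inE.
    by case: eqVneq => // ->; rewrite sS.
  + move=> _; congr (_, _); apply/setP => x; rewrite !inE.
    by case: (x =P s) => [->|_]; rewrite ?sS ?sS' ?orbT.
- apply: (@mono_comm _ _ _ _ _ _ _ ([ffun j => a j + a' j]%N, (S :|: S') :\ s)) => //=.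
  + rewrite /Rmc /= !inE sS (negPf sS') disjointD1l //=.
    case: (boolP [disjoint _ & _]) => d /=; last by ring.
    rewrite !mul0r add0r !mul1r !sgnM; apply: sgn_odd.
    rewrite (invsDl _ sS) cnt_disjointU // card_disjointU //.
    by parity.
  + by rewrite (negPf sS') !mul0r eqxx.
  + move=> _; congr (_, _); apply/setP => x; rewrite !inE.
    by case: eqVneq => // ->; rewrite (negPf sS').
- apply: (@mono_comm _ _ _ _ _ _ _ ([ffun j => a j + a' j]%N, (S :|: S') :\ s)) => //=.
  + rewrite /Rmc /= !inE sS' (negPf sS) disjointD1r //=.
    case: (boolP [disjoint _ & _]) => d /=; last by ring.
    rewrite !mul0r mulr0 addr0 !mul1r !sgnM; apply: sgn_odd.
    rewrite (invsDr _ sS') cnt_disjointU // card_disjointU // -(cnt_cgt sS).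
    by parity.
  + move=> _; congr (_, _); apply/setP => x; rewrite !inE.
    by case: eqVneq => // ->; rewrite (negPf sS).
  + by rewrite (negPf sS) !mul0r mulr0 eqxx.
- apply: (@mono_comm _ _ _ _ _ _ _ ([ffun j => a j + a' j]%N, (S :|: S') :\ s)) => //=.
  + by rewrite /Rmc /= !inE (negPf sS') (negPf sS) /=; ring.
  + by rewrite (negPf sS') !mul0r eqxx.
  + by rewrite (negPf sS) !mul0r mulr0 eqxx.
Qed.

End ROperators.

(** * The divergence and Cartan's formula *)

Section AbstractCartan.
Variables (F : fieldType) (I : finType) (R L M : lmodType F).
Variable t : R -> {linear L -> M}.
Hypothesis tl : forall v, linear (fun u => t u v).
Variables (p : I -> {linear R -> R}) (i : I -> {linear L -> L}) (d : {linear M -> M}).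
Hypothesis d_tens : forall u v, d (t u v) = \sum_k t (p k u) (i k v).

Lemma tDl u u' v : t (u + u') v = t u v + t u' v.
Proof. by have := tl v 1 u u'; rewrite !scale1r. Qed.
Lemma tZl a u v : t (a *: u) v = a *: t u v.
Proof. by rewrite -[a *: u]addr0 tl -[t 0 v](addKr (t 0 v)) -tDl addr0 addNr addr0. Qed.

(** Exchanging the two summation indices multiplies the first factor by [kappa] and the second by
    [- kappa], so the double sum is its own negative. *)
Lemma d_square (kappa : I -> I -> F) :
  (2%:R != 0 :> F) -> (forall k l, kappa k l * kappa k l = 1) ->
  (forall k l u, p k (p l u) = kappa k l *: p l (p k u)) ->
  (forall k l v, i k (i l v) = - kappa k l *: i l (i k v)) ->
  forall u v, d (d (t u v)) = 0.
Proof.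
move=> ch2 k2 pp ii u v.
have -> : d (d (t u v)) = \sum_l \sum_k t (p k (p l u)) (i k (i l v)).
  by rewrite d_tens linear_sum; apply: eq_bigr => l _; rewrite d_tens.
set S := \sum_l _; have SN : S = - S.
  rewrite {1}/S exchange_big -sumrN; apply: eq_bigr => l _ /=.
  rewrite -sumrN; apply: eq_bigr => k _ /=.
  by rewrite pp ii tZl linearZ /= scalerA mulrN k2 scaleN1r.
have /eqP: 2%:R *: S = 0 by rewrite scaler_nat mulr2n {1}SN addNr.
by rewrite scaler_eq0 (negPf ch2) => /eqP.
Qed.

Variables (m : {linear R -> R}) (e : {linear L -> L}) (E : {linear M -> M}).
Hypothesis E_tens : forall u v, E (t u v) = t (m u) (e v).

(** The products of [m (p l u)] with [e (i l v)] cancel between the two orders. There remain the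
    pairing term at [l = k] and the terms in which [p l] differentiates the multiplier. Values are
    named through equations so that an instance never has to unify concrete elements. *)
Lemma cartan k (g : I -> R) (z : I -> L) w x b u v :
  t u v = b -> m (p k u) = x ->
  (forall l, p l (m u) = m (p l u) + g l) -> (forall l, e (i l v) = z l) ->
  (forall l, i l (e v) + z l = (l == k)%:R *: w) ->
  d (E b) + E (d b) = t x w + \sum_l t (g l) ((l == k)%:R *: w - z l).
Proof.
move=> <- <- pm ez ie; rewrite E_tens !d_tens linear_sum -big_split /=.
rewrite [t _ w](_ : _ = \sum_l t (m (p l u)) ((l == k)%:R *: w)); last first.
  rewrite (bigD1 k) //= eqxx scale1r big1 ?addr0 // => l /negPf ->.
  by rewrite scale0r linear0.
rewrite -big_split; apply: eq_bigr => l _ /=.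
by rewrite E_tens pm -ie addrK tDl linearD /= ez addrAC.
Qed.

End AbstractCartan.

Lemma twisted_anticomm (F : fieldType) (V : lmodType F) (a k d : F) (y w : V) :
  a *: (- k *: y + d *: w) + (a * k) *: y = d *: (a *: w).
Proof.
rewrite scalerDr !scalerA addrAC -scalerDl mulrN addNr scale0r add0r.
by rewrite mulrC.
Qed.

Section Divergence.
Variables (F : fieldType) (m n : nat).
Notation RR := (RR F m n).
Notation L0 := (L0 F m n).
Notation MM := (MM F m n).
Notation Rmon := (Rmon m n).
Notation OmMon := (OmMon m n).
Notation Bas := (Bas m n).
Notation idx := (idx m n).
Implicit Types (c r : Rmon) (o : OmMon) (k l : idx) (b : Bas).

Lemma mulmonE c r : mulmon F c r = Rm F c r.
Proof.
rewrite /mulmon card_invs /Rm /mono /Rmc.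
by case: ifP => _; rewrite ?mul1r // mul0r scale0r.
Qed.

Lemma dymonE s r : dymon F s r = ((s \in r.2)%:R * sgn F (cnt r.2 s)) *: << Rpf (inr s) r >>.
Proof. by rewrite /dymon; case: ifP => _; rewrite ?mul1r // mul0r scale0r. Qed.

Lemma dymon_Rp s r : dymon F s r = sgn F #|r.2| *: Rp F (inr s) r.
Proof.
rewrite dymonE /Rp /mono scalerA /=; apply: (congr1 (fun a => a *: _)).
by rewrite -sgnM mulrCA (mulrC (sgn F #|_|)) -mulrA sgn_sqr mulr1.
Qed.

Lemma mulR_dxmon i c r : mulR (dxmon F i c) << r >> = Rg F (inl i) c r.
Proof.
rewrite mulRUr; have -> : dxmon F i c = (c.1 i)%:R *: << Rpf (inl i) c >> by [].
by rewrite lextZU mulmonE /Rm /mono scalerA.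
Qed.

Lemma mulR_dymon s c r :
  mulR (dymon F s c) << r >> = sgn F (#|c.2| + #|r.2|) *: Rg F (inr s) c r.
Proof.
rewrite mulRUr dymonE lextZU mulmonE /Rm /mono /Rg !scalerA /=.
by rewrite [in RHS]mulrA sgn_sqr mul1r.
Qed.

Definition bsum o := (\sum_(s < n) o.2 s)%N.

(** Odd wedges commute with odd contractions up to the pairing. Since an odd contraction lowers
    [bsum] by one, the extra sign turns this into anticommutation; the pairing term then carries the
    same sign, recorded by [osign]. *)
Definition ehat k o : L0 :=
  if k is inr _ then sgn F (bsum o) *: ome F k o else ome F k o.
Definition osign k o : L0 := if k is inr _ then sgn F (bsum o) *: << o >> else << o >>.

Definition div_basis b : MM := \sum_k tens (Rp F k b.1) (omi F k b.2).
Definition div : MM -> MM := lext div_basis.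
HB.instance Definition _ := GRing.Linear.copy div (lext div_basis).
Definition wedge c k : MM -> MM := tens_op (Rm F c) (ehat k).
HB.instance Definition _ c k := GRing.Linear.copy (wedge c k) (tens_op (Rm F c) (ehat k)).

Lemma div_tens u v : div (tens u v) = \sum_k tens (lext (Rp F k) u) (lext (omi F k) v).
Proof.
under eq_bigr do rewrite -tens_op_tens.
by rewrite /div /tens_op -lext_sum; apply: eq_lext.
Qed.

Lemma tens_linear_l (v : L0) : linear (fun u : RR => tens u v).
Proof. by move=> a u u'; rewrite tensDl tensZl. Qed.

Lemma divU r o : div << (r, o) >> = \sum_k tens (Rp F k r) (omi F k o).
Proof. exact: lextU. Qed.

Lemma wedge_tens c k u v : wedge c k (tens u v) = tens (lext (Rm F c) u) (lext (ehat k) v).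
Proof. exact: tens_op_tens. Qed.

Lemma koszul_sqr k l : koszul F k l * koszul F k l = 1.
Proof. exact: sgn_sqr. Qed.

Lemma linear_eq0 (f : {linear MM -> MM}) : (forall b, f << b >> = 0) -> forall v, f v = 0.
Proof.
move=> f0 v; rewrite linear_lext; transitivity (lext (fun b => 0 *: f << b >>) v).
  by apply: eq_lext => b; rewrite f0 scaler0.
by rewrite lextZ scale0r.
Qed.

Lemma div_div v : 2%:R != 0 :> F -> div (div v) = 0.
Proof.
move=> ch2; apply: (linear_eq0 (f := div \o div)) => -[r o] /=.
have := @d_square F idx RR L0 MM (fun u => tens u) tens_linear_l
  (fun k => lext (Rp F k)) (fun k => lext (omi F k)) div div_tens (@koszul F m n)
  ch2 koszul_sqr (fun k l => lext_swap (@Rp_Rp F m n k l))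
  (fun k l => lext_swap (@omi_omi F m n k l)) << r >> << o >>.
by rewrite /= tensUU.
Qed.

Lemma bsum_omif k o : omic F k o != 0 ->
  sgn F (bsum (omif k o)) = sgn F (bsum o + ipar k).
Proof.
case: o => T b; case: k => [i|s]; rewrite /= ?addn0 // => ne.
have bs : (0 < b s)%N by rewrite lt0n; apply: contraNneq ne => ->; rewrite mul0r.
apply: sgn_odd; rewrite /bsum /= [in LHS](bigD1 s) // [in RHS](bigD1 s) //=.
rewrite ffunE eqxx (eq_bigr b) => [|t /negPf ts]; last by rewrite ffunE ts subn0.
by rewrite -{2}(prednK bs) subn1; parity.
Qed.

Lemma ehat_omi s k o : lext (ehat (inr s)) (omi F k o) =
  (sgn F (bsum o) * koszul F k (inr s)) *: lext (ome F (inr s)) (omi F k o).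
Proof.
have E (h : OmMon -> L0) : lext h (omi F k o) = omic F k o *: h (omif k o).
  by rewrite omiE lextZU.
apply: (etrans (E _)); apply: etrans (congr1 (fun v => _ *: v) (esym (E _))).
rewrite /ehat /koszul muln1.
move: (ome F (inr s) (omif k o)) => w.
rewrite [LHS]scalerA [RHS]scalerA; apply: (congr1 (fun a => a *: w)).
have [->|ne] := eqVneq (omic F k o) 0; first by rewrite mul0r mulr0.
by rewrite bsum_omif // -sgnM mulrC.
Qed.

Lemma omi_ehat l k o :
  lext (omi F l) (ehat k o) + lext (ehat k) (omi F l o) = (l == k)%:R *: osign k o.
Proof.
case: k => [i|s].
  have := @omi_ome F m n l (inl i) o; rewrite /koszul muln0 scaleN1r => e.
  by rewrite [X in X + _]e addrAC addNr add0r.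
have e1 : lext (omi F l) (ehat (inr s) o) = sgn F (bsum o) *: lext (omi F l) (ome F (inr s) o).
  exact: linearZ_LR.
apply: (etrans (congr2 +%R (etrans e1 (congr1 _ (@omi_ome F m n l (inr s) o))) (ehat_omi s l o))).
exact: twisted_anticomm.
Qed.

End Divergence.

Lemma add_sum_sum (V : zmodType) (I J : finType) (x y : V) (D : I + J -> V) (f : I -> V)
    (g : J -> V) :
  x = y -> (forall i, f i = D (inl i)) -> (forall j, g j = D (inr j)) ->
  x + \sum_i f i + \sum_j g j = y + \sum_k D k.
Proof.
move=> -> ef eg; rewrite big_sumType /= addrA; congr (_ + _ + _); exact: eq_bigr.
Qed.

Lemma scaled_xi (F : fieldType) (V : lmodType F) (a e s g h : F) (d : bool) (y w y' w' : V) :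
  w' = g *: w -> y' = h *: y -> a = s * h -> (d -> e = s * g) ->
  - a *: y + (if d then e *: w else 0) = s *: (d%:R *: w' - y').
Proof.
move=> -> -> -> ed; rewrite scalerBr addrC !scalerA scaleNr; congr (_ - _).
by case: d ed => [->//|_]; rewrite ?mulr1 // mulr0 mul0r scale0r.
Qed.

Section Cartan.
Variables (F : fieldType) (m n : nat).
Notation RR := (RR F m n).
Notation L0 := (L0 F m n).
Notation MM := (MM F m n).
Notation Rmon := (Rmon m n).
Notation OmMon := (OmMon m n).
Notation Bas := (Bas m n).
Notation idx := (idx m n).
Implicit Types (c r : Rmon) (o : OmMon) (k l : idx) (b : Bas).

(** Up to sign, the action of E_lk on the second factor. The diagonal term is matched by the weight
    of 1_E, which is 1 on even and -1 on odd indices; this is why Cartan's formula holds with the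
    Berezinian twist. *)
Definition cform k l o : L0 := (l == k)%:R *: osign F k o - lext (ehat F k) (omi F l o).

Lemma cartanU c k r o :
  div (wedge c k << (r, o) >>) + wedge c k (div << (r, o) >>) =
  tens (lext (Rm F c) (Rp F k r)) (osign F k o) + \sum_l tens (Rg F l c r) (cform k l o).
Proof.
have E1 (h : Rmon -> RR) : lext h << r >> = h r by apply: lextU.
have E2 (h : OmMon -> L0) : lext h << o >> = h o by apply: lextU.
apply: (@cartan F idx RR L0 MM (fun u => tens u) (@tens_linear_l F m n)
  (fun l => lext (Rp F l)) (fun l => lext (omi F l)) (@div F m n) (@div_tens F m n)
  (lext (Rm F c)) (lext (ehat F k)) (wedge c k) (wedge_tens c k) k
  (fun l => Rg F l c r) (fun l => lext (ehat F k) (omi F l o)) _ _ _ << r >> << o >>).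
- exact: tensUU.
- exact: (congr1 (lext (Rm F c)) (E1 _)).
- move=> l; apply: (etrans (congr1 (lext (Rp F l)) (E1 _))).
  apply: (etrans (Rp_Rm F l c r)).
  exact: (congr1 (fun x => lext (Rm F c) x + _) (esym (E1 _))).
- move=> l; exact: (congr1 (lext (ehat F k)) (E2 _)).
- move=> l; apply: etrans (omi_ehat F l k o).
  exact: (congr1 (fun x => lext (omi F l) x + _) (E2 _)).
Qed.

Lemma mulR_Rp c k r : mulR << c >> (Rp F k r) = lext (Rm F c) (Rp F k r).
Proof. by rewrite mulRUl; apply: eq_lext => r'; apply: mulmonE. Qed.

Lemma mulR_dymon_l c s r :
  mulR << c >> (dymon F s r) = sgn F #|r.2| *: lext (Rm F c) (Rp F (inr s) r).
Proof.
rewrite dymon_Rp; apply: (etrans (mulRUl c _)); apply: (etrans (linearZ_LR _ _ _)).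
exact: (congr1 _ (etrans (esym (mulRUl c _)) (mulR_Rp _ _ _))).
Qed.

Lemma xi_cform_even k i o : xi F k (inl i) o = sgn F (ipar k) *: cform (inl i) k o.
Proof.
apply: (etrans (xiE F k (inl i) o)); apply: (@scaled_xi F L0 _ _ _ 1 1).
- by rewrite scale1r.
- by rewrite scale1r.
- by case: k => [j|s]; rewrite /= /sgn ?expr0 ?expr1 ?mulr1.
- by case: k => [j|s] //= _; rewrite /sgn expr0 mulr1.
Qed.

Lemma xi_cform_odd k s o :
  xi F k (inr s) o = sgn F (bsum o + ipar k) *: cform (inr s) k o.
Proof.
apply: (etrans (xiE F k (inr s) o)).
apply: (scaled_xi (h := sgn F (bsum o) * koszul F k (inr s)) (erefl : osign F (inr s) o = _)).
- exact: ehat_omi.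
- rewrite /koszul !sgnM muln1; apply: sgn_odd; case: k => [j|t] /=; by parity.
- by case: k => [j|t] //= _; rewrite sgnM (@sgn_odd _ _ 1) //; parity.
Qed.

(** The sum over [idx] in [cartanU] splits into its even and odd indices, which are the two sums of
    the mixed-product formula. *)
Lemma actPbE c i r o : actPb F c i (r, o) =
  div (wedge c (inl i) << (r, o) >>) + wedge c (inl i) (div << (r, o) >>).
Proof.
rewrite cartanU /actPb [X in _ + X]scaler_sumr; apply: add_sum_sum => [|j|s].
- exact: (congr1 (fun u => tens u _) (mulR_Rp c (inl i) r)).
- apply: (congr2 (fun u v => tens u v) (mulR_dxmon F j c r)).
  by apply: (etrans (xi_cform_even _ _ _)); rewrite /= /sgn expr0 scale1r.
- apply: (etrans (congr1 _ (congr2 (fun u v => tens u v) (mulR_dymon F s c r) (xi_cform_even _ _ _)))).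
  apply: (etrans (tens_scaled (e := 1) _ _ _)); last exact: scale1r.
  by rewrite !sgnM; apply: (@sgn_odd _ _ 0); rewrite /rpar /=; parity.
Qed.

Lemma actDbE c s r o : actDb F c s (r, o) = sgn F (#|r.2| + bsum o) *:
  (div (wedge c (inr s) << (r, o) >>) + wedge c (inr s) (div << (r, o) >>)).
Proof.
rewrite cartanU /actDb [in RHS]scalerDr.
rewrite [X in _ = _ + X]scaler_sumr [X in _ + X + _]scaler_sumr [X in _ + _ + X = _]scaler_sumr.
apply: add_sum_sum => [|j|t].
- apply: (etrans (congr1 (fun u => tens u _) (mulR_dymon_l c s r))).
  apply: (etrans (tensZl _ _ _)); apply/esym.
  have := @tens_scaled F m n (sgn F (#|r.2| + bsum o)) 1 (sgn F (bsum o)) (sgn F #|r.2|)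
    (lext (Rm F c) (Rp F (inr s) r)) << o >>; rewrite scale1r; apply.
  by rewrite mulr1 sgnM; apply: sgn_odd; parity.
- apply: (etrans (congr1 _ (congr2 (fun u v => tens u v) (mulR_dxmon F j c r) (xi_cform_odd _ _ _)))).
  have := @tens_scaled F m n (sgn F (rpar r)) 1 (sgn F (bsum o + 0)) (sgn F (#|r.2| + bsum o))
    (Rg F (inl j) c r) (cform (inr s) (inl j) o); rewrite scale1r; apply.
  by rewrite mulr1 sgnM addn0.
- apply: (etrans (congr1 _ (congr2 (fun u v => tens u v) (mulR_dymon F t c r) (xi_cform_odd _ _ _)))).
  by apply: tens_scaled; rewrite !sgnM; apply: sgn_odd; rewrite /rpar /=; parity.
Qed.

End Cartan.

Lemma eq_linear (F : fieldType) (K : choiceType) (V : lmodType F)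
    (f g : {linear {malg F[K]} -> V}) :
  (forall k, f << k >> = g << k >>) -> forall v, f v = g v.
Proof.
move=> e v; rewrite (linear_lext f v) (linear_lext g v).
exact: eq_lext.
Qed.

Lemma scale_swap (F : fieldType) (V : lmodType F) (a b : F) (v : V) :
  a *: (b *: v) = b *: (a *: v).
Proof. by rewrite !scalerA mulrC. Qed.

(** Since d squares to 0, both sides reduce to d E d. *)
Lemma cartan_comm (F : fieldType) (V : lmodType F) (d E : {linear V -> V}) v :
  (forall w, d (d w) = 0) ->
  d (d (E v) + E (d v)) = d (E (d v)) + E (d (d v)).
Proof. by move=> dd; rewrite linearD /= !dd linear0 add0r addr0. Qed.

(** * Equivariance of the divergence *)

Section Equivariance.
Variables (F : fieldType) (m n : nat).
Notation RR := (RR F m n).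
Notation L0 := (L0 F m n).
Notation MM := (MM F m n).
Notation Rmon := (Rmon m n).
Notation OmMon := (OmMon m n).
Notation Bas := (Bas m n).
Notation idx := (idx m n).
Implicit Types (c r : Rmon) (o : OmMon) (k l : idx) (b : Bas) (v : MM).

Lemma tens_ZU (a e : F) r o : tens (a *: << r >>) (e *: << o >>) = (a * e) *: << (r, o) >> :> MM.
Proof.
have := @tens_scaled F m n 1 a e _ << r >> << o >> erefl.
by rewrite scale1r tensUU mul1r.
Qed.

Lemma div_mono k r o : tens (Rp F k r) (omi F k o) =
  (Rpc F k r * omic F k o) *: << (Rpf k r, omif k o) >> :> MM.
Proof. exact: tens_ZU. Qed.

Lemma ehatE k o : ehat F k o =
  (sgn F (ipar k * bsum o) * omec F k o) *: << omef k o >>.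
Proof.
rewrite /ehat; case: k => [i|s]; rewrite omeE; first by rewrite mul0n sgn0 mul1r.
by rewrite /= mul1n scalerA.
Qed.

Definition diag (phi : Bas -> F) : MM -> MM := lext (fun b => phi b *: << b >>).
HB.instance Definition _ phi :=
  GRing.Linear.copy (diag phi) (lext (fun b => phi b *: << b >>)).

Lemma diagU phi b : diag phi << b >> = phi b *: << b >>.
Proof. exact: lextU. Qed.

Lemma diag_coef phi v b : (diag phi v)@_b = phi b * v@_b.
Proof. exact: lext_diag_coef. Qed.

(** Such functions give diagonal operators that commute with [div]; the instances are the parity
    sign, the weight and functions of these. *)
Definition div_invariant (T : Type) (phi : Bas -> T) :=
  forall k r o, Rpc F k r * omic F k o != 0 -> phi (Rpf k r, omif k o) = phi (r, o).

Lemma div_diag phi v : div_invariant phi -> div (diag phi v) = diag phi (div v).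
Proof.
move=> inv.
apply: (@eq_linear F Bas MM (@div F m n \o diag phi) (diag phi \o @div F m n)) => -[r o] /=.
rewrite diagU.
apply: (etrans (linearZ_LR _ _ _)); rewrite /= divU.
apply: esym; apply: etrans; first exact: linear_sum.
apply: etrans; last by apply: esym; exact: scaler_sumr.
apply: eq_bigr => k _; rewrite div_mono.
apply: (etrans (linearZ_LR _ _ _)); rewrite /= diagU.
have [->|ne] := eqVneq (Rpc F k r * omic F k o) 0; first by rewrite !scale0r scaler0.
apply: (etrans (congr1 (fun a => _ *: (a *: _)) (inv _ _ _ ne))).
exact: scale_swap.
Qed.

(* The parity of a basis element: the action of f D_s picks up this sign when it is
   compared with the Cartan anticommutator. *)
Definition twist_sign b : F := sgn F (#|b.1.2| + bsum b.2).
Notation twist := (diag twist_sign).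

(** An even k changes neither count; an odd k removes one y_s and one e*_{m+s}, so the total drops
    by two. *)
Lemma twist_sign_inv : div_invariant twist_sign.
Proof.
move=> k r o; rewrite mulf_eq0 negb_or => /andP[nr no].
rewrite /twist_sign -!sgnM bsum_omif // !sgnM; case: k nr {no} => [i|s] /= nr.
  by rewrite addn0.
apply: sgn_odd; rewrite [in RHS](cardsD1 s) /=.
have -> : s \in r.2 by apply: contraNT nr => /negPf ->; rewrite mul0r.
by parity.
Qed.

Lemma actPE c i v : actP c i v = div (wedge c (inl i) v) + wedge c (inl i) (div v).
Proof.
have -> : div (wedge c (inl i) v) + wedge c (inl i) (div v) =
  ((@div F m n \o wedge c (inl i)) \+ (wedge c (inl i) \o @div F m n)) v by [].
apply: (@eq_linear F Bas MM (lext (actPb F c i))) => -[r o] /=.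
by apply: (etrans (lextU _ _)); exact: actPbE.
Qed.

Lemma actDE c s v : actD c s v =
  div (wedge c (inr s) (twist v)) + wedge c (inr s) (div (twist v)).
Proof.
have -> : div (wedge c (inr s) (twist v)) + wedge c (inr s) (div (twist v)) =
  (((@div F m n \o wedge c (inr s)) \+ (wedge c (inr s) \o @div F m n)) \o twist) v by [].
apply: (@eq_linear F Bas MM (lext (actDb F c s))) => -[r o] /=.
apply: (etrans (lextU _ _)); apply: etrans; first exact: actDbE.
rewrite diagU.
apply: (etrans (scalerDr _ _ _)); apply: (congr2 +%R).
  by apply: etrans (esym (congr1 _ (linearZ_LR _ _ _))); apply: esym; exact: linearZ_LR.
by apply: etrans (esym (congr1 _ (linearZ_LR _ _ _))); apply: esym; exact: linearZ_LR.
Qed.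

Hypothesis ch2 : 2%:R != 0 :> F.

Lemma div_actP c i v : div (actP c i v) = actP c i (div v).
Proof.
apply: (etrans (congr1 _ (actPE c i v))); apply: etrans (esym (actPE c i (div v))).
by apply: cartan_comm => w; apply: div_div.
Qed.

Lemma div_actD c s v : div (actD c s v) = actD c s (div v).
Proof.
apply: (etrans (congr1 _ (actDE c s v))); apply: etrans (esym (actDE c s (div v))).
apply: (etrans (cartan_comm _ _ _)) => [w|]; first exact: div_div.
exact: (congr1 (fun w => div (wedge c (inr s) w) + wedge c (inr s) (div w)) (div_diag v twist_sign_inv)).
Qed.

End Equivariance.

(** * Gradings and the contracting homotopy *)

Section Gradings.
Variables (F : fieldType) (m n : nat).
Notation RR := (RR F m n).
Notation L0 := (L0 F m n).
Notation MM := (MM F m n).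
Notation Rmon := (Rmon m n).
Notation OmMon := (OmMon m n).
Notation Bas := (Bas m n).
Notation idx := (idx m n).
Implicit Types (c r : Rmon) (o : OmMon) (k l : idx) (b : Bas) (v : MM).

Lemma Vq_0 q : Vq q (0 : MM).
Proof. by move=> b; rewrite msupp0 inE. Qed.
Lemma Vq_D q u v : Vq q u -> Vq q v -> Vq q (u + v).
Proof.
move=> hu hv b /(fsubsetP (msuppD_le _ _)); rewrite inE => /orP[/hu//|/hv//].
Qed.
Lemma Vq_Z q a v : Vq q v -> Vq q (a *: v).
Proof. by move=> hv b /(fsubsetP (msuppZ_le _ _)) /hv. Qed.
Lemma Vq_U q b : omdeg b.2 = q -> Vq q (<< b >> : MM).
Proof. by move=> hb b' /(fsubsetP msuppU_le); rewrite inE => /eqP ->. Qed.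
Lemma Vq_ZU q a b : (a != 0 -> omdeg b.2 = q) -> Vq q (a *: << b >> : MM).
Proof.
have [->|_ /(_ isT) e] := eqVneq a 0; first by rewrite scale0r => _; apply: Vq_0.
by apply: Vq_Z; apply: Vq_U.
Qed.
Lemma Vq_sum q (I : Type) (s : seq I) (f : I -> MM) :
  (forall i, Vq q (f i)) -> Vq q (\sum_(i <- s) f i).
Proof. by move=> hf; apply: big_ind => //; [apply: Vq_0|move=> x y; apply: Vq_D]. Qed.

Lemma Vq_lext q q' (h : Bas -> MM) v :
  (forall b, omdeg b.2 = q -> Vq q' (h b)) -> Vq q v -> Vq q' (lext h v).
Proof.
move=> hh hv; apply: msupp_ind => [|u w|a u|b /hv]; last exact: hh.
- exact: Vq_0.
- exact: Vq_D.
- exact: Vq_Z.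
Qed.

Lemma omdeg_omif k o : omic F k o != 0 -> omdeg o = (omdeg (omif k o)).+1.
Proof.
case: o => T b; case: k => [i|s] /= ne; rewrite /omdeg /=.
  have iT : i \in T by apply: contraNT ne => /negPf ->; rewrite mul0r.
  by rewrite (cardsD1 i T) iT.
have bs : (0 < b s)%N by rewrite lt0n; apply: contraNneq ne => ->; rewrite mul0r.
rewrite -addnS; congr (_ + _)%N; rewrite [in LHS](bigD1 s) // [in RHS](bigD1 s) //=.
rewrite ffunE eqxx subn1 -addSn prednK //; congr (_ + _)%N.
by apply: eq_bigr => t /negPf ts; rewrite ffunE ts subn0.
Qed.

Lemma omdeg_omef k o : omec F k o != 0 -> omdeg (omef k o) = (omdeg o).+1.
Proof.
case: o => T b; case: k => [i|s] /= ne; rewrite /omdeg /=.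
  have iT : i \notin T by apply: contraNN ne => ->; rewrite mul0r.
  by rewrite cardsU1 iT.
rewrite -addnS; congr (_ + _)%N; rewrite [in LHS](bigD1 s) // [in RHS](bigD1 s) //=.
rewrite ffunE eqxx addn1 -addSn; congr (_ + _)%N.
by apply: eq_bigr => t /negPf ts; rewrite ffunE ts addn0.
Qed.

Lemma Vq_div q v : Vq q v -> Vq q.-1 (div v).
Proof.
apply: Vq_lext => -[r o] /= oq; apply: Vq_sum => k.
rewrite div_mono; apply: Vq_ZU; rewrite mulf_eq0 negb_or => /andP[_ /omdeg_omif].
by rewrite oq => ->.
Qed.

Lemma div_Vq0 v : Vq 0 v -> div v = 0.
Proof.
move=> hv; apply: (@msupp_ind F Bas MM (fun w => w = 0)) => [//|u w -> ->|a u ->|[r o] /hv /= o0].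
- by rewrite addr0.
- by rewrite scaler0.
- rewrite /div_basis big1 // => k _; rewrite div_mono.
  have [->|] := eqVneq (omic F k o) 0; first by rewrite mulr0 scale0r.
  by move=> /omdeg_omif; rewrite o0.
Qed.

Lemma wedgeU c k r o : wedge c k << (r, o) >> =
  (Rmc F c r * (sgn F (ipar k * bsum o) * omec F k o)) *: << (Rmf c r, omef k o) >>.
Proof. by apply: etrans; [exact: tens_opU | rewrite ehatE; exact: tens_ZU]. Qed.

Lemma Vq_wedge c k q v : Vq q v -> Vq q.+1 (wedge c k v).
Proof.
apply: Vq_lext => -[r o] /= oq.
have := wedgeU c k r o; rewrite [LHS]tens_opU /= => ->; apply: Vq_ZU.
by rewrite !mulf_eq0 !negb_or => /and3P[_ _ /omdeg_omef ->]; rewrite oq.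
Qed.

Lemma Vq_diag phi q v : Vq q v -> Vq q (diag phi v).
Proof. by apply: Vq_lext => b bq; apply: Vq_Z; apply: Vq_U. Qed.

Lemma Vq_cartan c k q v : Vq q v -> Vq q (div (wedge c k v) + wedge c k (div v)).
Proof.
move=> hv; apply: Vq_D; first exact: (Vq_div (Vq_wedge hv)).
(* For q = 0, [q.-1.+1] is not [q], but there [div] vanishes. *)
case: q hv => [|q] hv; last exact: (Vq_wedge (Vq_div hv)).
by rewrite div_Vq0 // linear0; apply: Vq_0.
Qed.

Lemma Vq_actP c i q v : Vq q v -> Vq q (actP c i v).
Proof. by rewrite actPE; apply: Vq_cartan. Qed.

Lemma Vq_actD c s q v : Vq q v -> Vq q (actD c s v).
Proof. by rewrite actDE => hv; apply: Vq_cartan; apply: Vq_diag. Qed.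

(** Eigenvalues of x_i d_i and of -y_s D_s. For even i the letter e*_i contributes -1 and the factor
    1_E contributes +1, which together indicate that e*_i is absent; for odd s the roles of
    polynomial and letter are exchanged. *)
Definition wtk k b : nat :=
  match k with
  | inl i => b.1.1 i + (i \notin b.2.1)
  | inr s => b.2.2 s + (s \notin b.1.2)
  end.
Definition wt b : nat := \sum_k wtk k b.

(** A nonzero term of [div] removes x_i together with e*_i, or y_s together with e*_{m+s}: an
    exponent drops by one while the indicator of absence rises from 0 to 1. *)
Lemma wt_inv : div_invariant F wt.
Proof.
move=> k [a S] [T b]; rewrite mulf_eq0 negb_or => /andP[nr no].
apply: eq_bigr => -[j|t] _; case: k nr no => [i|s] //= nr no; rewrite ffunE !inE.
  have iT : i \in T by apply: contraNT no => /negPf ->; rewrite mul0r.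
  have ai : (0 < a i)%N by rewrite lt0n; apply: contraNneq nr => ->.
  by case: eqVneq => [->|_]; rewrite /= ?iT /= ?subn0 ?subn1 ?addn1 ?prednK ?addn0.
have sS : s \in S by apply: contraNT nr => /negPf ->; rewrite mul0r.
have bs : (0 < b s)%N by rewrite lt0n; apply: contraNneq no => ->; rewrite mul0r.
by case: eqVneq => [->|_]; rewrite /= ?sS /= ?subn0 ?subn1 ?addn1 ?prednK ?addn0.
Qed.

Definition zbas : Bas := (([ffun => 0%N], setT), (setT, [ffun => 0%N])).

Lemma wt_eq0 b : (wt b == 0%N) = (b == zbas).
Proof.
apply/eqP/eqP => [|->]; last first.
  by rewrite /wt big1 // => -[i|s] _ /=; rewrite ffunE !inE.
case: b => -[a S] [T b] /eqP; rewrite sum_nat_eq0 => /forallP h.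
rewrite /zbas; congr (_, _, (_, _)).
- by apply/ffunP => i; rewrite ffunE; have := h (inl i); rewrite /= addn_eq0 => /andP[/eqP].
- by apply/setP => s; rewrite inE; have := h (inr s); rewrite /= addn_eq0 => /andP[_]; case: (_ \in _).
- by apply/setP => s; rewrite inE; have := h (inl s); rewrite /= addn_eq0 => /andP[_]; case: (_ \in _).
- by apply/ffunP => i; rewrite ffunE; have := h (inr i); rewrite /= addn_eq0 => /andP[/eqP].
Qed.

End Gradings.

Lemma collapse_sum (F : fieldType) (V : lmodType F) (I : finType) (k : I) (e : F) (f : I -> V) :
  \sum_l ((l == k)%:R * e) *: f l = e *: f k.
Proof.
rewrite (bigD1 k) //= eqxx mul1r big1 ?addr0 // => l /negPf ->.
by rewrite mul0r scale0r.
Qed.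

Lemma scaler1B (F : fieldType) (V : lmodType F) (a c e : F) (x y w : V) :
  x = a *: w -> y = c *: w -> a - c = e -> true%:R *: x - y = e *: w.
Proof. by move=> -> -> <-; rewrite scale1r scalerBl. Qed.

Lemma scale_add (F : fieldType) (V : lmodType F) (e a b c : F) (x y w : V) :
  x = a *: w -> y = b *: w -> e * (a + b) = c -> e *: (x + y) = c *: w.
Proof. by move=> -> -> <-; rewrite -scalerDl scalerA. Qed.

Section Homotopy.
Variables (F : fieldType) (m n : nat).
Notation RR := (RR F m n).
Notation L0 := (L0 F m n).
Notation MM := (MM F m n).
Notation Rmon := (Rmon m n).
Notation OmMon := (OmMon m n).
Notation Bas := (Bas m n).
Notation idx := (idx m n).
Implicit Types (c r : Rmon) (o : OmMon) (k l : idx) (b : Bas) (v : MM).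

(** The coordinate x_i or y_s; used as coefficient in direction k it gives the k-th Euler field. *)
Definition genr k : Rmon :=
  match k with
  | inl i => ([ffun j => (j == i) : nat], set0)
  | inr s => ([ffun => 0%N], [set s])
  end.

Lemma Rmc_set0 a r : Rmc F (a, set0) r = 1.
Proof. by rewrite /Rmc /invs big_set0 -setI_eq0 set0I eqxx mulr1. Qed.

Lemma Rmf_rone r : Rmf (rone m n) r = r.
Proof.
case: r => a S; rewrite /Rmf /= set0U; congr (_, _).
by apply/ffunP => i; rewrite !ffunE.
Qed.

Lemma Rpf_genr k : Rpf k (genr k) = rone m n.
Proof.
case: k => [i|s] /=; congr (_, _).
  by apply/ffunP => j; rewrite !ffunE subnn.
by rewrite setDv.
Qed.

(** A coordinate has constant derivatives. The sign is the twist by the parity of y_s r, whence the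
    successor. *)
Lemma Rg_genr l k r :
  Rg F l (genr k) r = ((l == k)%:R * sgn F (ipar k * #|r.2|.+1)) *: << r >>.
Proof.
have e : Rgc F l (genr k) r = (l == k)%:R * sgn F (ipar k * #|r.2|.+1).
  case: l k => [i|s] [j|t] /=.
  - have -> : (inl i == inl j :> idx) = (i == j) by [].
    by rewrite ffunE Rmc_set0.
  - by rewrite ffunE !mul0r.
  - by rewrite inE !mul0r mulr0.
  - have -> : (inr s == inr t :> idx) = (s == t) by [].
    rewrite inE; have [->|_] := eqVneq s t; last by rewrite !mul0r mulr0.
    rewrite setDv Rmc_set0 cards1 !mul1r mulr1 mul1n.
    have -> : cnt [set t] t = 0%N by rewrite cnt_sum big_set1 ltnn.
    by rewrite sgn0 mulr1.
apply: (eq_scaleU e); rewrite e => ne.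
have /eqP -> : l == k by apply: contraNT ne => /negPf ->; rewrite mul0r.
by rewrite Rpf_genr Rmf_rone.
Qed.

(** A single term of the sum in [cartanU] survives. At [l = k] this computes the Euler fields; at
    the last odd [l] it isolates the action on the second factor for the generation argument. *)
Lemma cartan_genr l k r o :
  div (wedge (genr l) k << (r, o) >>) + wedge (genr l) k (div << (r, o) >>) =
  tens (lext (Rm F (genr l)) (Rp F k r)) (osign F k o)
  + sgn F (ipar l * #|r.2|.+1) *: tens << r >> (cform F k l o).
Proof.
rewrite cartanU; apply: (congr1 (fun w => _ + w)).
apply: etrans (collapse_sum l _ (fun j => tens << r >> (cform F k j o))).
by apply: eq_bigr => j _; rewrite Rg_genr tensZl.
Qed.

Lemma Rm_Rp_genr k r : lext (Rm F (genr k)) (Rp F k r) =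
  (if k is inr s then (s \in r.2)%:R * sgn F #|r.2| else Rpc F k r) *: << r >>.
Proof.
case: r => a S; apply: (etrans (lext_mono _ _ _ _ _)); apply: eq_scaleU; case: k => [i|s] /=.
- by rewrite Rmc_set0 mulr1.
- case: (boolP (s \in S)) => sS; rewrite ?mul0r ?mul1r // /Rmc /=.
  rewrite /invs big_set1 (cntD s sS) ltnn add0n -sgnM.
  have -> : [disjoint [set s] & S :\ s].
    by rewrite -setI_eq0; apply/eqP/setP => x; rewrite !inE; case: (x == s).
  by rewrite mul1r mulrC mulrA sgn_sqr mul1r.
- rewrite Rmc_set0 mulr1 => ne; rewrite /Rmf /= set0U; congr (_, _).
  apply/ffunP => j; rewrite !ffunE; case: eqVneq => [->|_]; last by rewrite subn0.
  by rewrite subnKC // lt0n; apply: contraNneq ne => ->.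
- move=> ne; have sS : s \in S by apply: contraNT ne => /negPf ->; rewrite !mul0r.
  by rewrite /Rmf /= setD1K //; congr (_, _); apply/ffunP => j; rewrite !ffunE.
Qed.

Lemma ome_omi k o : lext (ome F k) (omi F k o) =
  (if k is inr s then (o.2 s)%:R else omic F k o * omic F k o) *: << o >>.
Proof.
case: o => T b; apply: (etrans (lext_mono _ _ _ _ _)); apply: eq_scaleU; case: k => [i|s] /=.
- case: (boolP (i \in T)) => iT; last by rewrite !mul0r.
  by rewrite !inE eqxx /= (cntD i iT) ltnn add0n.
- by rewrite -mulrA sgn_sqr mulr1.
- move=> ne; have iT : i \in T by apply: contraNT ne => /negPf ->; rewrite !mul0r.
  by rewrite setD1K.
- move=> ne; rewrite binc_bdec_pos // lt0n; apply: contraNneq ne => ->.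
  by rewrite !mul0r.
Qed.

Lemma cform_diag k o : cform F k k o =
  (if k is inr s then sgn F (bsum o) * (1 + (o.2 s)%:R) else (wtk k (rone m n, o))%:R) *: << o >>.
Proof.
rewrite /cform eqxx; case: k => [i|s].
  apply: (scaler1B (esym (scale1r _)) (ome_omi (inl i) o)); rewrite /= ffunE add0n.
  case: (i \in o.1); last by rewrite !mul0r subr0.
  by rewrite !mul1r sgn_sqr subrr.
apply: (@scaler1B F L0 _ (- (sgn F (bsum o) * (o.2 s)%:R)) _ _ _ _ (erefl : osign F (inr s) o = _)).
  apply: (etrans (ehat_omi F s (inr s) o)).
  apply: (etrans (congr1 _ (ome_omi (inr s) o))); apply: (etrans (scalerA _ _ _)).
  by apply: (congr1 (fun a => a *: _)); rewrite /koszul muln1 /sgn expr1 mulrN1 mulNr.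
by rewrite opprK mulrDr mulr1.
Qed.

(** The twist turns the anticommutator into the action of y_s D_s, and the minus sign turns the
    eigenvalues of that field, which are never positive, into natural numbers. *)
Definition hsign k b : F := if k is inr _ then - twist_sign F b else 1.

Lemma hsign_inv k : div_invariant F (hsign k).
Proof. by move=> l r o; case: k => [//|s] ne; rewrite /= twist_sign_inv. Qed.

Definition homotopy v : MM := \sum_k wedge (genr k) k (diag (hsign k) v).

Lemma homotopy_termU k b :
  hsign k b *: (div (wedge (genr k) k << b >>) + wedge (genr k) k (div << b >>)) =
  (wtk k b)%:R *: << b >>.
Proof.
case: b => r o; rewrite cartan_genr Rm_Rp_genr cform_diag.
have t1 (x y : F) : tens (x *: << r >>) (y *: << o >>) = (x * y) *: << (r, o) >> by apply: tens_ZU.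
have t2 (z y : F) : z *: tens << r >> (y *: << o >>) = (z * y) *: << (r, o) >> :> MM.
  by apply: (etrans (congr1 _ (linearZ_LR _ _ _))); rewrite /= tensUU; exact: scalerA.
case: k => [i|s].
  have e1 := t1 (Rpc F (inl i) r) 1; rewrite scale1r in e1.
  apply: (scale_add e1 (t2 _ _)).
  by rewrite /= mul0n sgn0 !mul1r mulr1 ffunE add0n natrD.
apply: (scale_add (t1 _ _) (t2 _ _)); rewrite /= /twist_sign mul1n /= -sgnM -[sgn F _.+1]sgnN natrD.
have := sgn_sqr F (bsum o); have := sgn_sqr F #|r.2|.
move: (sgn F (bsum o)) (sgn F #|r.2|) => x y ex ey.
transitivity ((x * x) * (y * y) * ((o.2 s)%:R + 1 - (s \in r.2)%:R)); first by ring.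
by rewrite ex ey; case: (s \in r.2) => /=; ring.
Qed.

(** As [hsign] is invariant under [div], the anticommutator splits into one summand for each k, and
    these are given by [homotopy_termU]. *)
Lemma homotopy_identity v : div (homotopy v) + homotopy (div v) = diag (fun b => (wt b)%:R) v.
Proof.
pose D k (w : MM) := div (wedge (genr k) k w) + wedge (genr k) k (div w).
have -> : div (homotopy v) + homotopy (div v) = \sum_k D k (diag (hsign k) v).
  rewrite /homotopy [div _]linear_sum -big_split; apply: eq_bigr => k _ /=.
  exact: (congr1 (fun w => _ + wedge (genr k) k w) (esym (div_diag v (@hsign_inv k)))).
pose G k := ((@div F m n \o wedge (genr k) k) \+ (wedge (genr k) k \o @div F m n)) \o diag (hsign k).
have GE k w : G k w = lext (fun b => (wtk k b)%:R *: << b >>) w.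
  apply: (@eq_linear F Bas MM (G k) (lext (fun b => (wtk k b)%:R *: << b >>))) => b /=.
  rewrite diagU; apply: etrans (esym (lextU _ _)); apply: etrans (homotopy_termU k b).
  apply: etrans; last by apply: esym; exact: scalerDr.
  apply: (congr2 +%R); apply: (etrans (congr1 _ (linearZ_LR _ _ _))); exact: linearZ_LR.
transitivity (\sum_k G k v) => //.
rewrite (eq_bigr _ (fun k _ => GE k v)) -lext_sum; apply: eq_lext => b.
by rewrite /wt natr_sum scaler_suml.
Qed.

Lemma homotopy0 : homotopy 0 = 0.
Proof. by rewrite /homotopy big1 // => k _; rewrite !linear0. Qed.

Lemma Vq_homotopy q v : Vq q v -> Vq q.+1 (homotopy v).
Proof. by move=> hv; apply: Vq_sum => k; apply/Vq_wedge/Vq_diag. Qed.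

Hypothesis ch0 : [pchar F] =i pred0.

Lemma natr_neq0 p : (0 < p)%N -> p%:R != 0 :> F.
Proof. by move=> p0; have /pcharf0P -> := ch0; rewrite -lt0n. Qed.

Lemma closed_exact q v : Vq q v -> div v = 0 -> v@_(zbas m n) = 0 ->
  exists2 w, Vq q.+1 w & v = div w.
Proof.
(* The primitive is the homotopy divided by the weight; the division commutes with [div] because the
   weight is invariant. *)
move=> hv dv v0; exists (diag (fun b => (wt b)%:R^-1) (homotopy v)).
  by apply/Vq_diag/Vq_homotopy.
have inv : div_invariant F (fun b => (wt b)%:R^-1 : F).
  by move=> k r o ne; rewrite (wt_inv ne).
have e : div (homotopy v) = diag (fun b => (wt b)%:R) v.
  by rewrite -homotopy_identity dv homotopy0 addr0.
apply: etrans (esym (div_diag _ inv)); apply: etrans (esym (congr1 _ e)).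
apply/malgP => b; rewrite !diag_coef mulrA.
(* Only [zbas] has weight 0, and there the convention 0^-1 = 0 does no harm because the coefficient
   of [v] vanishes. *)
have [/eqP|wt0] := posnP (wt b); first by rewrite wt_eq0 => /eqP ->; rewrite v0 mulr0.
move: (v@_b) (natr_neq0 wt0) => x wtn.
by rewrite (mulVf wtn) mul1r.
Qed.

(** [div] preserves the weight, so only [zbas] itself could contribute, and it has no x_i to
    differentiate and no e*_{m+s} to contract. *)
Lemma zbas_not_exact v : (div v)@_(zbas m n) = 0.
Proof.
rewrite lext_coef big1 // => -[r o] _; rewrite /div_basis raddf_sum /= big1 ?mulr0 // => k _.
rewrite div_mono mcoeffZ mcoeffU; case: eqP => [e|_]; last by rewrite mulr0.
have [->|ne] := eqVneq (Rpc F k r * omic F k o) 0; first by rewrite mul0r.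
have := wt_inv ne; rewrite e => /esym/eqP; rewrite (eqP (etrans (wt_eq0 _) (eqxx _))) wt_eq0 => /eqP z.
by case: z ne => -> ->; case: k {e} => [i|s]; rewrite /= ffunE ?mul0r ?mulr0 eqxx.
Qed.

Lemma div_zbas : div << zbas m n >> = 0 :> MM.
Proof.
apply: (etrans (lextU _ _)); rewrite /div_basis big1 // => -[i|s] _; rewrite div_mono /= ffunE.
  by rewrite mul0r scale0r.
by rewrite mul0r mulr0 scale0r.
Qed.

End Homotopy.

Lemma saturated x y z q : (q - z = 0 -> x + (z + y) = q -> [/\ x = 0, y = 0 & z = q])%N.
Proof. by split; lia. Qed.

(** * Generation of V(theta_q) *)

Section Generation.
Variables (F : fieldType) (m n : nat).
Notation RR := (RR F m n).
Notation L0 := (L0 F m n).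
Notation MM := (MM F m n).
Notation Rmon := (Rmon m n).
Notation OmMon := (OmMon m n).
Notation Bas := (Bas m n).
Notation idx := (idx m n).
Implicit Types (c r : Rmon) (o : OmMon) (k l : idx) (b : Bas) (v : MM).

Hypothesis ch0 : [pchar F] =i pred0.
Variable s0 : 'I_n.
Hypothesis s0_max : val s0 = n.-1.

Lemma not_s0_lt (s : 'I_n) : (s0 < s)%N = false.
Proof.
apply/negbTE; rewrite -leqNgt -[leqRHS]/(val s0) s0_max -ltnS prednK ?ltn_ord //.
by case: (n) s => // -[].
Qed.

Lemma set_last : [set s : 'I_n | val s == n.-1] = [set s0].
Proof. by apply/setP => s; rewrite !inE -s0_max. Qed.

Definition womega q : OmMon := (set0, elast n q).

Lemma elastE q s : elast n q s = if s == s0 then q else 0%N.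
Proof. by rewrite ffunE -s0_max. Qed.

Lemma bsum_womega q : bsum (womega q) = q.
Proof.
rewrite /bsum (bigD1 s0) //= elastE eqxx big1 ?addn0 // => s /negPf ns.
by rewrite elastE ns.
Qed.

Lemma cform_womega q l : cform F (inr s0) l (womega q) =
  ((l == inr s0)%:R * (sgn F q * (1 + q%:R))) *: << womega q >>.
Proof.
have [->|/negPf ne] := eqVneq l (inr s0).
  apply: (etrans (cform_diag F _ _)); apply: (congr1 (fun a => a *: _)).
  by rewrite bsum_womega mul1r /= elastE eqxx.
rewrite /cform ne mul0r scale0r (_ : omi F l (womega q) = 0).
  by rewrite lext0 scale0r subr0.
rewrite omiE (_ : omic F l (womega q) = 0) ?scale0r //.
case: l ne => [i|s] /= ne; first by rewrite inE mul0r.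
by rewrite elastE (_ : s == s0 = false) ?mul0r.
Qed.

Lemma Rm_rone c : Rm F c (rone m n) = << c >>.
Proof.
rewrite /Rm /mono (_ : Rmc F c _ = 1) ?scale1r.
  congr << _ >>; case: c => a S; rewrite /Rmf /= setU0; congr (_, _).
  by apply/ffunP => i; rewrite !ffunE addn0.
rewrite /Rmc /= /invs -setI_eq0 setI0 eqxx mul1r big1 // => s _.
by rewrite cnt_sum big_set0.
Qed.

Definition ylast : Rmon := ([ffun => 0%N], [set s0]).

(** y_{s0} is the last factor of any monomial containing it: the sign of differentiating it away
    cancels against the twist, and multiplying it back on the right costs none. *)
Lemma Rg_ylast c : Rg F (inr s0) c ylast = (s0 \in c.2)%:R *: << c >>.
Proof.
apply: eq_scaleU => /=.
  case: (boolP (s0 \in c.2)) => sc; last by rewrite !mul0r mulr0.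
  have cgt0 (A : {set 'I_n}) : cgt A s0 = 0%N.
    by rewrite /cgt big1 // => a _; rewrite not_s0_lt.
  have i0 : invs (c.2 :\ s0) [set s0] = 0%N.
    by rewrite /invs big1 // => a _; rewrite cnt_sum big_set1 not_s0_lt.
  have := @cnt_cgt n (c.2 :\ s0) s0; rewrite cgt0 addn0 !inE eqxx => /(_ isT) cc.
  rewrite (cntD s0 sc) ltnn add0n {}cc (cardsD1 s0 c.2) sc cards1 /Rmc /= i0.
  have -> : [disjoint c.2 :\ s0 & [set s0]].
    by rewrite -setI_eq0; apply/eqP/setP => x; rewrite !inE; case: (x == s0); rewrite ?andbF.
  rewrite !mul1r sgn0 mulr1 sgnM; apply: (@sgn_odd _ _ 0); by parity.
move=> ne; have sc : s0 \in c.2 by apply: contraNT ne => /negPf ->; rewrite !mul0r mulr0.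
case: c sc {ne} => a S /= sc; rewrite /Rmf /= setUC setD1K //; congr (_, _).
by apply/ffunP => i; rewrite !ffunE addn0.
Qed.

(** The coefficient is 1 or -q. For q > 0 a single field c D_n therefore reaches every c (x)
    (e*_{m+n})^q from the generator. *)
Lemma actD_genq q c : actD c s0 (genq F m n q) =
  (1 - (s0 \in c.2)%:R * (1 + q%:R)) *: << (c, womega q) >>.
Proof.
have -> : genq F m n q = << (ylast, womega q) >> by rewrite /genq set_last.
apply: (etrans (lextU _ _)); apply: etrans; first exact: actDbE.
rewrite cartanU.
have e1 : tens (lext (Rm F c) (Rp F (inr s0) ylast)) (osign F (inr s0) (womega q)) =
    (sgn F 1 * sgn F q) *: << (c, womega q) >>.
  have -> : lext (Rm F c) (Rp F (inr s0) ylast) = sgn F 1 *: << c >>.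
    have -> : Rp F (inr s0) ylast = sgn F 1 *: << rone m n >>.
      rewrite /Rp /mono /= inE eqxx cards1 mul1r cnt_sum big_set1 ltnn add0n.
      by rewrite setDv.
    by rewrite lextZU Rm_rone.
  by rewrite /osign bsum_womega; exact: tens_ZU.
have e2 : \sum_l tens (Rg F l c ylast) (cform F (inr s0) l (womega q)) =
    ((s0 \in c.2)%:R * (sgn F q * (1 + q%:R))) *: << (c, womega q) >>.
  apply: etrans; last first.
    apply: (etrans (collapse_sum (inr s0) (sgn F q * (1 + q%:R))
      (fun l => tens (Rg F l c ylast) << womega q >>))).
    rewrite Rg_ylast tensZl tensUU; apply: (etrans (scalerA _ _ _)).
    by apply: (congr1 (fun a => a *: _)); rewrite mulrC.
  apply: eq_bigr => l _; rewrite cform_womega; exact: linearZ_LR.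
apply: (scale_add e1 e2); rewrite /= cards1 bsum_womega -[sgn F (1 + q)]sgnM.
transitivity (sgn F q * sgn F q * (1 - (s0 \in c.2)%:R * (1 + q%:R))).
  by rewrite /(sgn F 1) expr1; move: (sgn F q) (_%:R) => x y; ring.
by rewrite sgn_sqr mul1r.
Qed.

(** Induction on the number of letters other than e*_{m+n}: each monomial comes from one with fewer
    such letters by trading one e*_{m+n} for e*_k. *)
Lemma omega_ind q (Q : OmMon -> Prop) :
  Q (womega q) ->
  (forall k o, k != inr s0 -> omic F (inr s0) o != 0 ->
     omec F k (omif (inr s0) o) != 0 -> Q o -> Q (omef k (omif (inr s0) o))) ->
  forall o, omdeg o = q -> Q o.
Proof.
move=> Qw step o.
move: {2}(q - o.2 s0)%N (erefl (q - o.2 s0)%N) => t.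
elim: t o => [|t IH] [T b] /= bt; rewrite /omdeg /= (bigD1 s0) //= => deg.
  suff -> : (T, b) = womega q by [].
  have [T0 b0 bq] := saturated bt deg.
  rewrite /womega; congr (_, _); first by apply: cards0_eq.
  apply/ffunP => s; rewrite elastE; case: eqVneq => [->|ns]; first by [].
  by move/eqP: b0; rewrite sum_nat_eq0 => /forallP /(_ s); rewrite ns => /eqP.
have icn (T' : {set 'I_m}) (b' : {ffun 'I_n -> nat}) : omic F (inr s0) (T', binc s0 b') != 0.
  by rewrite /= ffunE eqxx addn1 mulf_neq0 ?natr_neq0 // /sgn signr_eq0.
have [T0|[i iT]] := set_0Vmem T.
  (* Without even letters, and with fewer than q letters [s0], some other odd letter must occur. *)
  have /forallPn[s] : ~~ [forall i, (i != s0) ==> (b i == 0%N)].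
    rewrite -sum_nat_eq0; apply/eqP => b0; move: bt.
    by rewrite -deg T0 cards0 b0 addn0 add0n subnn.
  rewrite negb_imply -lt0n => /andP[ns bs].
  have e : omef (inr s) (omif (inr s0) (T, binc s0 (bdec s b))) = (T, b) :> OmMon.
    by rewrite /= bdec_binc binc_bdec_pos.
  rewrite -e; apply: step => //.
  - by rewrite /= /sgn signr_eq0.
  - apply: IH; first by rewrite /= !ffunE eqxx eq_sym (negPf ns); lia.
    have := @omdeg_omef F m n (inr s0) (T, bdec s b).
    have := @omdeg_omif F m n (inr s) (T, b).
    rewrite /omec /omic /sgn signr_eq0 => /(_ _) h1 /(_ isT) /= ->.
    rewrite -h1; last by rewrite mulf_neq0 ?natr_neq0 // signr_eq0.
    by rewrite /omdeg /= (bigD1 s0).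
have e : omef (inl i) (omif (inr s0) (T :\ i, binc s0 b)) = (T, b) :> OmMon.
  by rewrite /= bdec_binc setD1K.
rewrite -e; apply: step => //.
- by rewrite /= !inE eqxx mul1r /sgn signr_eq0.
- apply: IH; first by rewrite /= !ffunE eqxx; lia.
  have := @omdeg_omef F m n (inr s0) (T :\ i, b).
  rewrite /omec /sgn signr_eq0 => /(_ isT) /= ->.
  by rewrite -deg (cardsD1 i T) iT /omdeg /= [in LHS](bigD1 s0) //=; lia.
Qed.

Variables (q : nat) (P : MM -> Prop).
Hypotheses (q_gt0 : (0 < q)%N) (sub : IsSubmod P) (Pgen : P (genq F m n q)).

Lemma submod_scaleV a v : a != 0 -> P (a *: v) -> P v.
Proof.
move=> a0 Pv; have [_ _ PZ _ _] := sub.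
have := PZ a^-1 _ Pv; rewrite [X in P X]scalerA mulVf //.
by rewrite scale1r.
Qed.

Lemma submod_addr u v : P u -> P (u + v) -> P v.
Proof.
have [_ PD PZ _ _] := sub.
move=> Pu Puv; have := PD _ _ (PZ (-1) _ Pu) Puv.
by rewrite scaleN1r addKr.
Qed.

Lemma gen_womega c : P << (c, womega q) >>.
Proof.
have [_ _ _ _ PDact] := sub; have := PDact c s0 _ Pgen; rewrite actD_genq.
apply: submod_scaleV; case: (_ \in _); rewrite ?mul0r ?subr0 ?oner_eq0 //.
by rewrite mul1r opprD addrA subrr add0r oppr_eq0 natr_neq0.
Qed.

Lemma submod_cartan c k r o : P << (r, o) >> ->
  P (div (wedge c k << (r, o) >>) + wedge c k (div << (r, o) >>)).
Proof.
have [_ _ PZ PPact PDact] := sub; case: k => [i|s] Pro.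
  by rewrite -actPE; apply: PPact.
have := PDact c s _ Pro; rewrite [actD _ _ _]lextU actDbE.
by apply: submod_scaleV; rewrite /sgn signr_eq0.
Qed.

(** The field with coefficient y_{s0} in direction k sends r (x) o to a multiple of some r' (x) o,
    already in [P], plus a term that leaves r alone and trades e*_{m+n} for e*_k in o. Subtracting
    the former isolates the latter. *)
Lemma submod_step k o : k != inr s0 -> omic F (inr s0) o != 0 ->
  omec F k (omif (inr s0) o) != 0 ->
  (forall r, P << (r, o) >>) -> forall r, P << (r, omef k (omif (inr s0) o)) >>.
Proof.
move=> ks0 ic ec Po r; have [_ _ PZ _ _] := sub.
have := submod_cartan (genr (inr s0)) k (Po r); rewrite cartan_genr.
move=> h; have {h} : P (sgn F (ipar (inr s0 : idx) * #|r.2|.+1)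
    *: tens << r >> (cform F k (inr s0) o)).
  apply: (submod_addr _ h); rewrite [lext _ _]lext_mono.
  have -> : osign F k o = (if k is inr _ then sgn F (bsum o) else 1) *: << o >>.
    by case: (k) => //= i; rewrite scale1r.
  by rewrite tens_ZU {h}; apply: PZ (Po _).
move=> /(submod_scaleV _) h.
have {h} : P (tens << r >> (cform F k (inr s0) o)) by apply: h; rewrite /sgn signr_eq0.
have -> : cform F k (inr s0) o =
    - (omic F (inr s0) o * (sgn F (ipar k * bsum (omif (inr s0) o)) *
         omec F k (omif (inr s0) o))) *: << omef k (omif (inr s0) o) >>.
  rewrite /cform eq_sym (negPf ks0) scale0r sub0r scaleNr; congr (- _).
  by rewrite omiE lextZU ehatE; exact: scalerA.
have -> a w : tens << r >> (a *: << w >>) = a *: << (r, w) >> :> MM.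
  by apply: (etrans (linearZ_LR _ _ _)); rewrite /= tensUU.
apply: submod_scaleV; rewrite oppr_eq0 mulf_neq0 // mulf_neq0 //.
by rewrite /sgn signr_eq0.
Qed.

Lemma gen_omega o r : omdeg o = q -> P << (r, o) >>.
Proof.
move=> od; move: r; move: o od; apply: omega_ind => [|k o ks0 ic ec Po].
  exact: gen_womega.
exact: submod_step.
Qed.

Lemma genq_generates v : Vq q v -> P v.
Proof.
have [P0 PD PZ _ _] := sub; move=> hv; rewrite -(lext_id v).
by apply: (msupp_ind P0 PD PZ) => -[r o] ob; apply: gen_omega; exact: (hv _ ob).
Qed.

End Generation.

(** * The complex *)

Section Complex.
Variables (F : fieldType) (m n : nat).
Notation RR := (RR F m n).
Notation L0 := (L0 F m n).
Notation MM := (MM F m n).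
Notation Rmon := (Rmon m n).
Notation OmMon := (OmMon m n).
Notation Bas := (Bas m n).
Notation idx := (idx m n).
Implicit Types (c r : Rmon) (o : OmMon) (k l : idx) (b : Bas) (u v w : MM) (q : nat).

Hypotheses (ch0 : [pchar F] =i pred0) (n_gt0 : (0 < n)%N).

Let last_lt : (n.-1 < n)%N. Proof. by rewrite prednK. Qed.
Let s0 : 'I_n := Ordinal last_lt.
Let s0_max : val s0 = n.-1. Proof. by []. Qed.

Lemma two_neq0 : 2%:R != 0 :> F. Proof. exact: natr_neq0. Qed.

Lemma divK v : div (div v) = 0. Proof. exact: div_div two_neq0. Qed.

Lemma divD u v : div (u + v) = div u + div v. Proof. exact: linearD. Qed.
Lemma divZ a v : div (a *: v) = a *: div v. Proof. exact: linearZ_LR. Qed.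

(** The factor q comes from contracting a q-th power, the minus sign from the parity twist in [Rp]
    applied to the odd y_n. *)
Lemma div_genq q : div (genq F m n q) = - q%:R *: tgtq F m n q.
Proof.
have -> : genq F m n q = << (ylast m s0, womega m n q) >> by rewrite /genq (set_last s0_max).
rewrite divU; apply: etrans; last first.
  apply: (etrans (collapse_sum (inr s0 : idx) (- q%:R)
    (fun k => << (Rpf k (ylast m s0), omif k (womega m n q)) >> : MM))).
  apply: (congr1 (fun b => _ *: << b >>)); rewrite /= /rone setDv; congr (_, (_, _)).
  apply/ffunP => s; rewrite !ffunE; have -> : (s == s0) = (val s == n.-1) by [].
  by case: eqP => _; rewrite ?subn1.
apply: eq_bigr => k _; rewrite div_mono; apply: (congr1 (fun a => a *: _)).
case: k => [i|s] /=; first by rewrite ffunE !mul0r.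
have -> : (inr s == inr s0 :> idx) = (s == s0) by [].
rewrite inE cards0; case: eqVneq => [->|_]; last by rewrite !mul0r.
rewrite cards1 cnt_sum big_set1 ltnn add0n (elastE s0_max) eqxx sgn0 mulr1 !mul1r.
by rewrite /sgn expr1 mulN1r.
Qed.

Lemma tgtq_neq0 q : tgtq F m n q != 0.
Proof.
apply/eqP => /(congr1 (fun v : MM => v@_(rone m n, (set0, elast n q.-1)))).
by rewrite mcoeffUU mcoeff0 => /eqP; rewrite oner_eq0.
Qed.

Lemma div_genq_neq0 q : (0 < q)%N -> div (genq F m n q) <> 0.
Proof.
move=> q0 /eqP; rewrite div_genq scaler_eq0 (negPf (tgtq_neq0 q)) orbF oppr_eq0.
by apply/negP; apply: natr_neq0.
Qed.

Lemma Vq_genq q : Vq q (genq F m n q).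
Proof.
apply: Vq_U; rewrite /= /omdeg cards0 add0n.
exact: (bsum_womega m s0_max q).
Qed.

Lemma omdeg_womega q : omdeg (womega m n q) = q.
Proof. by rewrite /omdeg cards0 add0n; exact: (bsum_womega m s0_max q). Qed.

Lemma actP_linear c i : linear (@actP F m n c i).
Proof. exact: lext_is_linear. Qed.
HB.instance Definition _ c i :=
  GRing.isLinear.Build F MM MM *:%R (@actP F m n c i) (actP_linear c i).
Lemma actD_linear c i : linear (@actD F m n c i).
Proof. exact: lext_is_linear. Qed.
HB.instance Definition _ c i :=
  GRing.isLinear.Build F MM MM *:%R (@actD F m n c i) (actD_linear c i).

Definition Exact q v := exists2 w, Vq q.+1 w & v = div w.

Lemma Exact_Vq q v : Exact q v -> Vq q v.
Proof. by case=> w hw ->; apply: (Vq_div hw). Qed.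

Lemma Exact_closed q v : Exact q v -> div v = 0.
Proof. by case=> w hw ->; apply: divK. Qed.

Lemma Exact_submod q : IsSubmod (Exact q).
Proof.
split.
- by exists 0; [exact: Vq_0 | rewrite linear0].
- move=> u v [u' hu ->] [v' hv ->]; exists (u' + v'); first exact: Vq_D.
  by apply: esym; exact: linearD.
- move=> a v [v' hv ->]; exists (a *: v'); first exact: Vq_Z.
  by apply: esym; exact: linearZ_LR.
- move=> c i v [v' hv ->]; exists (actP c i v'); first exact: Vq_actP.
  by apply: esym; exact: (div_actP two_neq0).
- move=> c i v [v' hv ->]; exists (actD c i v'); first exact: Vq_actD.
  by apply: esym; exact: (div_actD two_neq0).
Qed.

Lemma Exact_tgtq q : Exact q (tgtq F m n q.+1).
Proof.
exists ((- q.+1%:R)^-1 *: genq F m n q.+1); first by apply/Vq_Z/Vq_genq.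
apply: esym; apply: (etrans (linearZ_LR _ _ _)); rewrite /= div_genq.
apply: (etrans (scalerA _ _ _)); rewrite mulVf ?scale1r //.
by rewrite oppr_eq0 natr_neq0.
Qed.

(** The preimage of L(theta_q) under [div] is a submodule containing the generator of
    V(theta_{q+1}), because [div] sends it to a multiple of some 1 (x) o; so it contains
    everything. *)
Lemma Exact_Lq q v : Exact q v -> @Lq F m n q v.
Proof.
have sub : IsSubmod (fun w => @Lq F m n q (div w)).
  split.
  - by rewrite linear0; apply: Gen_zero.
  - by move=> u w hu hw; rewrite divD; exact: Gen_add hu hw.
  - by move=> a w hw; rewrite divZ; exact: Gen_scale hw.
  - by move=> c i w hw; rewrite (div_actP two_neq0); exact: Gen_actP hw.
  - by move=> c i w hw; rewrite (div_actD two_neq0); exact: Gen_actD hw.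
case=> w hw ->; apply: (genq_generates ch0 s0_max (ltn0Sn q) sub _ hw).
rewrite div_genq; apply: Gen_scale; apply: Gen_base.
by exists (womega m n q); split; first exact: omdeg_womega.
Qed.

Lemma div_rone o : div << (rone m n, o) >> = 0 :> MM.
Proof.
rewrite divU big1 // => k _; rewrite div_mono (_ : Rpc F k _ = 0) ?mul0r ?scale0r //.
by case: k => [i|s] /=; rewrite ?ffunE ?inE ?mul0r.
Qed.

(** The vectors 1 (x) o are closed, as there is nothing to differentiate, and differ from [zbas],
    which contains y_n. The homotopy makes them exact, and exact vectors form a submodule. *)
Lemma Lq_Exact q v : @Lq F m n q v -> Exact q v.
Proof.
have [E0 ED EZ EP EE] := Exact_submod q.
elim=> {v} [v [o [oq ->]]||u v _ hu _ hv|a v _ hv|c i v _ hv|c i v _ hv].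
- apply: (closed_exact ch0); first exact: Vq_U.
    exact: div_rone.
  rewrite mcoeffU; case: eqP => // e.
  by have: s0 \in (zbas m n).1.2; [rewrite inE | rewrite -e inE].
- exact: E0.
- exact: ED.
- exact: EZ.
- exact: EP.
- exact: EE.
Qed.

Lemma zbas_notin q v : q <> m -> Vq q v -> v@_(zbas m n) = 0.
Proof.
move=> qm hv; apply/mcoeff_outdom/negP => /hv /= dq; apply: qm; rewrite -dq /omdeg /=.
by rewrite cardsT card_ord big1 ?addn0 // => s _; rewrite ffunE.
Qed.

Lemma Vq_zvec : Vq m (zvec F m n).
Proof.
apply: Vq_U; rewrite /omdeg /= cardsT card_ord big1 ?addn0 // => s _.
by rewrite ffunE.
Qed.

Lemma zvec_closed : div (zvec F m n) = 0.
Proof. exact: div_zbas. Qed.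

Lemma zvec_not_exact : ~ Exact m (zvec F m n).
Proof.
case=> w _ /(congr1 (fun v : MM => v@_(zbas m n))).
by rewrite zbas_not_exact mcoeffUU => /eqP; rewrite oner_eq0.
Qed.

(** The subtraction kills the coefficient at [zbas], the only obstruction in [closed_exact]. *)
Lemma closed_mod_zvec v : Vq m v -> div v = 0 -> Exact m (v - v@_(zbas m n) *: zvec F m n).
Proof.
move=> hv dv; apply: (closed_exact ch0).
- by apply: Vq_D => //; rewrite -scaleNr; apply/Vq_Z/Vq_zvec.
- apply: (etrans (linearB _ _ _)); rewrite /= dv sub0r.
  by rewrite divZ zvec_closed scaler0 oppr0.
- by rewrite mcoeffB mcoeffZ mcoeffUU mulr1 subrr.
Qed.

Lemma actP_zvec c i : Exact m (actP c i (zvec F m n)).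
Proof.
exists (wedge c (inl i) (zvec F m n)); first exact: (Vq_wedge Vq_zvec).
by rewrite actPE zvec_closed linear0 addr0.
Qed.

Lemma actD_zvec c s : Exact m (actD c s (zvec F m n)).
Proof.
exists (wedge c (inr s) (diag (@twist_sign F m n) (zvec F m n))).
  by apply/Vq_wedge/Vq_diag/Vq_zvec.
have e : div (diag (@twist_sign F m n) (zvec F m n)) = 0.
  by rewrite (div_diag _ (@twist_sign_inv F m n)) zvec_closed linear0.
apply: (etrans (actDE _ _ _)); apply: (etrans (congr1 (fun x => _ + wedge c (inr s) x) e)).
by rewrite linear0 addr0.
Qed.

(** Inverse of the factor in [div_genq], so that the generator goes exactly to [tgtq]; at q = 0 the
    convention 0^-1 = 0 gives the zero map. *)
Definition ncoef q : F := - (q%:R)^-1.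

Lemma ncoef_neq0 q : (0 < q)%N -> ncoef q != 0.
Proof. by move=> q0; rewrite oppr_eq0 invr_eq0 natr_neq0. Qed.

Lemma diff_exists : IsDiffFamily (fun q v => ncoef q *: div v : MM).
Proof.
split=> [q q0|v hv]; last by rewrite div_Vq0 // scaler0.
split; last first.
  rewrite div_genq; apply: (etrans (scalerA _ _ _)).
  by rewrite /ncoef mulrNN mulVf ?scale1r // natr_neq0.
split.
- by move=> v hv; apply: Vq_Z; apply: Vq_div.
- move=> a u v hu hv; apply: (etrans (congr1 _ (linearP _ _ _ _))).
  apply: (etrans (scalerDr _ _ _)); apply: (congr1 (fun x => x + _)).
  exact: scale_swap.
- move=> c i v hv; apply: (etrans (congr1 _ (div_actP two_neq0 c i v))).
  by apply: esym; exact: linearZ_LR.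
- move=> c i v hv; apply: (etrans (congr1 _ (div_actD two_neq0 c i v))).
  by apply: esym; exact: linearZ_LR.
Qed.

Lemma diff_unique d q v : IsDiffFamily d -> Vq q v -> d q v = ncoef q *: div v.
Proof.
case=> [dq d0]; case: q => [|q] hv; first by rewrite d0 // div_Vq0 // scaler0.
have [[_ dlin dP dD] dgen] := dq q.+1 isT.
have [[_ dlin' dP' dD'] dgen'] := diff_exists.1 q.+1 isT.
have d00 : d q.+1 0 = 0.
  have := dlin (-1) 0 0 (@Vq_0 F m n _) (@Vq_0 F m n _).
  by rewrite scaler0 addr0 scaleN1r addNr.
(* The locus of agreement is a submodule. [Vq] is part of the predicate because [d] is constrained
   only on homogeneous vectors. *)
have sub : IsSubmod (fun v => Vq q.+1 v /\ d q.+1 v = ncoef q.+1 *: div v).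
  split.
  - by split; [exact: Vq_0 | rewrite d00 linear0 scaler0].
  - move=> u w [hu eu] [hw ew]; split; first exact: Vq_D.
    have := dlin 1 u w hu hw; have := dlin' 1 u w hu hw; rewrite !scale1r => -> ->.
    by rewrite eu ew.
  - move=> a w [hw ew]; split; first exact: Vq_Z.
    apply: (etrans (congr1 (d q.+1) (esym (addr0 (a *: w))))).
    apply: (etrans (dlin a w 0 hw (@Vq_0 F m n _))).
    apply: (etrans (congr1 (fun x => _ + x) d00)); apply: (etrans (addr0 _)).
    apply: (etrans (congr1 _ ew)); apply: (etrans (scale_swap _ _ _)).
    by apply: (congr1 (fun x => _ *: x)); apply: esym; exact: divZ.
  - move=> c i w [hw ew]; split; first exact: Vq_actP.
    apply: (etrans (dP c i w hw)); apply: etrans (esym (dP' c i w hw)).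
    exact: (congr1 (actP c i) ew).
  - move=> c i w [hw ew]; split; first exact: Vq_actD.
    apply: (etrans (dD c i w hw)); apply: etrans (esym (dD' c i w hw)).
    exact: (congr1 (actD c i) ew).
suff e : Vq q.+1 (genq F m n q.+1) /\
    d q.+1 (genq F m n q.+1) = ncoef q.+1 *: div (genq F m n q.+1).
  by case: (genq_generates ch0 s0_max (ltn0Sn q) sub e hv).
by split; [exact: Vq_genq | rewrite dgen'].
Qed.

Section Family.
Variables (d : nat -> MM -> MM) (hd : IsDiffFamily d).

Lemma KerDE q v : KerD d q v <-> Vq q v /\ div v = 0.
Proof.
split=> -[hv].
  rewrite (diff_unique hd hv) => e; split=> //; move/eqP: e; rewrite scaler_eq0.
  case: q hv => [|q] hv; first by rewrite div_Vq0.
  by rewrite (negPf (ncoef_neq0 _)) //= => /eqP.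
by move=> dv; split=> //; rewrite (diff_unique hd hv) dv scaler0.
Qed.

Lemma ImDE q v : ImD d q.+1 v <-> Exact q v.
Proof.
have nz := ncoef_neq0 (ltn0Sn q).
split=> -[w hw ->].
  rewrite (diff_unique hd hw); exists (ncoef q.+1 *: w); first exact: Vq_Z.
  by apply: esym; exact: linearZ_LR.
exists ((ncoef q.+1)^-1 *: w); first exact: Vq_Z.
rewrite (diff_unique hd (@Vq_Z F m n _ _ _ hw)); apply: esym.
apply: (etrans (congr1 _ (linearZ_LR _ _ _))); apply: (etrans (scalerA _ _ _)).
by rewrite mulfV // scale1r.
Qed.

End Family.

End Complex.

Unset Implicit Arguments.

Theorem mainTheorem11 (F : closedFieldType) (m n : nat) :
  [pchar F] =i pred0 -> (0 < m)%N -> (0 < n)%N ->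
  (exists d : nat -> MM F m n -> MM F m n, IsDiffFamily d) /\
  (forall d : nat -> MM F m n -> MM F m n, IsDiffFamily d ->
     (forall q v, Vq (q.+1) v -> d q (d q.+1 v) = 0)
  /\ (forall q, (1 <= q)%N -> Reducible F m n q)
  /\ (forall q, ModIso (ImD d q.+1) (@Lq F m n q))
  /\ (forall q, q <> m -> forall v, KerD d q v <-> ImD d q.+1 v)
  /\ [/\ KerD d m (zvec F m n), ~ ImD d m.+1 (zvec F m n),
         (forall v, KerD d m v ->
            exists a : F, ImD d m.+1 (v - a *: zvec F m n)),
         (forall c i, ImD d m.+1 (actP c i (zvec F m n))) &
         (forall c i, ImD d m.+1 (actD c i (zvec F m n)))]).
Proof.
move=> ch0 _ n_gt0; split.
  by exists (fun q v => ncoef F q *: div v); apply: diff_exists.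
move=> d hd.
have kerE := KerDE ch0 n_gt0 hd; have imE := ImDE ch0 n_gt0 hd.
split=> [q v hv|].
  have /imE/(Exact_closed ch0) e : ImD d q.+1 (d q.+1 v) by exists v.
  have /imE/Exact_Vq hw : ImD d q.+1 (d q.+1 v) by exists v.
  by have [] := (kerE q _).2 (conj hw e).
split=> [q q_gt0|].
  (* The exact vectors are a nonzero submodule since [tgtq] is exact, and a proper one since [genq]
     is not closed. *)
  exists (@Exact F m n q); split.
  - exact: Exact_submod.
  - exact: Exact_Vq.
  - exists (tgtq F m n q.+1); first exact: Exact_tgtq.
    by apply/eqP; apply: tgtq_neq0.
  - exists (genq F m n q); first exact: Vq_genq.
    by move/(Exact_closed ch0); apply: div_genq_neq0.
split=> [q|].
  (* Im d_{q+1} and L(theta_q) are the same subspace of V(theta_q), so the identity is the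
     isomorphism. *)
  exists id; split=> //; split=> //.
  - by move=> v /imE; apply: Exact_Lq.
  - by move=> w /(Lq_Exact ch0 n_gt0)/imE hw; exists w.
split=> [q qm v|].
  split=> [/kerE[hv dv]|/imE ev]; last first.
    by apply/kerE; split; [exact: Exact_Vq | exact: Exact_closed ev].
  by apply/imE; apply: (closed_exact ch0 hv dv); apply: zbas_notin qm hv.
split.
- by apply/kerE; split; [exact: Vq_zvec | exact: zvec_closed].
- by move/imE; apply: zvec_not_exact.
- by move=> v /kerE[hv dv]; exists v@_(zbas m n); apply/imE; apply: closed_mod_zvec.
- by move=> c i; apply/imE; apply: actP_zvec.
- by move=> c i; apply/imE; apply: actD_zvec.
Qed.
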